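(* Let $G$ be a finite simple connected graph on $n\geqslant 5$ vertices and let $\alpha\in[0,1)$ be rational. Assume that it is not the case that both $n$ is even and $c_\alpha$ is odd with $c_\alpha\geqslant 3$. If $\frac{\det \tilde{W}_{\alpha}(G)}{2^{\lfloor n/2\rfloor}}$ is an odd and square-free integer, and $\tilde{W}_{\alpha}(G)$ has full rank $n$ over $\mathbb{F}_p$ for every odd prime $p$ dividing $c_\alpha$, then $G$ is determined by its generalized $A_\alpha$-spectrum (DGA$_\alpha$S).
   Context: All graphs are finite, simple and undirected. For a graph $G$ on vertices $v_1,\dots,v_n$, $A(G)$ is its adjacency matrix, $D(G)=\mathrm{diag}(d_1,\dots,d_n)$ its diagonal degree matrix, and for $\alpha\in[0,1]$, $A_\alpha(G)=\alpha D(G)+(1-\alpha)A(G)$. The $A_\alpha$-spectrum $\mathrm{Spec}_\alpha(G)$ is the multiset of eigenvalues of $A_\alpha(G)$. $\bar G$ denotes the complement of $G$. For rational $\alpha\in[0,1)$, $c_\alpha$ is the smallest positive integer such that $c_\alpha\alpha$ and $c_\alpha(1-\alpha)$ are (nonnegative) integers, and $A_{c_\alpha}(G)=c_\alpha A_\alpha(G)$ (an integral matrix). With $\mathbf 1$ the all-ones vector, $\tilde W_\alpha(G)=\left[\mathbf 1,\frac{A_{c_\alpha}(G)\mathbf 1}{c_\alpha},\dots,\frac{A_{c_\alpha}(G)^{n-1}\mathbf 1}{c_\alpha}\right]$, an $n\times n$ integral matrix. Two graphs $G,H$ share the same generalized $A_\alpha$-spectrum if $\mathrm{Spec}_\alpha(G)=\mathrm{Spec}_\alpha(H)$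 and $\mathrm{Spec}_\alpha(\bar G)=\mathrm{Spec}_\alpha(\bar H)$. $G$ is DGA$_\alpha$S if every graph $H$ sharing the same generalized $A_\alpha$-spectrum with $G$ is isomorphic to $G$. *)

(* Defs.v *)
From mathcomp Require Import all_boot all_order all_algebra all_field.
From mathcomp Require Import finmap multiset.

Set Implicit Arguments.
Unset Strict Implicit.
Unset Printing Implicit Defensive.

Import GRing.Theory Num.Theory.
Local Open Scope mset_scope.
Local Open Scope ring_scope.

Record graph (n : nat) := Graph {
  adj :> rel 'I_n;
  adj_sym : symmetric adj;
  adj_irr : irreflexive adj
}.

Definition connected n (G : graph n) : Prop := forall x y, connect G x y.

Definition compl_adj n (G : graph n) : rel 'I_n :=
  fun x y => (x != y) && ~~ G x y.

Lemma compl_adj_sym n (G : graph n) : symmetric (compl_adj G).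
Proof. by move=> x y; rewrite /compl_adj eq_sym adj_sym. Qed.

Lemma compl_adj_irr n (G : graph n) : irreflexive (compl_adj G).
Proof. by move=> x; rewrite /compl_adj eqxx. Qed.

Definition compl n (G : graph n) : graph n :=
  Graph (@compl_adj_sym n G) (@compl_adj_irr n G).

Definition isomorphic n m (G : graph n) (H : graph m) : Prop :=
  exists2 f : 'I_n -> 'I_m, bijective f & forall x y, H (f x) (f y) = G x y.

Definition adj_mx n (G : graph n) : 'M[rat]_n := \matrix_(i, j) (G i j)%:R.

Definition deg n (G : graph n) (i : 'I_n) : nat := #|[set j | G i j]|.

Definition deg_mx n (G : graph n) : 'M[rat]_n :=
  diag_mx (\row_i (deg G i)%:R).

Definition A_alpha n (alpha : rat) (G : graph n) : 'M[rat]_n :=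
  alpha *: deg_mx G + (1 - alpha) *: adj_mx G.

(* The eigenvalues, with multiplicity, are taken in the algebraic numbers. *)
Definition spectrum n (M : 'M[algC]_n) : {mset algC} :=
  seq_mset (sval (closed_field_poly_normal (char_poly M))).

Lemma spectrumP n (M : 'M[algC]_n) :
  char_poly M = \prod_(z <- spectrum M) ('X - z%:P).
Proof.
rewrite /spectrum; case: closed_field_poly_normal => r /= E.
rewrite (perm_big _ (perm_eq_seq_mset r)) /=.
by move: E; rewrite (eqP (char_poly_monic M)) scale1r.
Qed.

Definition Spec n (alpha : rat) (G : graph n) : {mset algC} :=
  spectrum (map_mx ratr (A_alpha alpha G)).

(* H may have a different number of vertices a priori. *)
Definition same_gen_spec n m (alpha : rat) (G : graph n) (H : graph m) : Prop :=
  Spec alpha G = Spec alpha H /\ Spec alpha (compl G) = Spec alpha (compl H).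

Definition DGAS n (alpha : rat) (G : graph n) : Prop :=
  forall (m : nat) (H : graph m), same_gen_spec alpha G H -> isomorphic H G.

(* For 0 <= alpha <= 1 the two integers are automatically nonnegative. *)
Definition clears (alpha : rat) (c : nat) : bool :=
  [&& (0 < c)%N, c%:R * alpha \is a Num.int & c%:R * (1 - alpha) \is a Num.int].

Lemma clears_ex (alpha : rat) : exists c, clears alpha c.
Proof.
exists `|denq alpha|%N; rewrite /clears absz_gt0 denq_neq0 /=.
have E : `|denq alpha|%N%:R * alpha = (numq alpha)%:~R.
  have -> : `|denq alpha|%N%:R = (denq alpha)%:~R :> rat.
    by rewrite -[in RHS]absz_denq.
  by rewrite mulrC -numqE.
by rewrite mulrBr mulr1 E intr_int rpredB ?intr_int ?rpred_nat.
Qed.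

Definition c_alpha (alpha : rat) : nat := ex_minn (clears_ex alpha).

Definition A_c n (alpha : rat) (G : graph n) : 'M[rat]_n :=
  (c_alpha alpha)%:R *: A_alpha alpha G.

Definition Wtilde n (alpha : rat) (G : graph n) : 'M[rat]_n :=
  \matrix_(i, j)
    if (j : nat) == 0%N then 1
    else ((A_c alpha G ^+ j) *m (const_mx 1 : 'cV_n)) i 0 / (c_alpha alpha)%:R.

Lemma c_alphaP alpha : clears alpha (c_alpha alpha).
Proof. by rewrite /c_alpha; case: ex_minnP. Qed.

Lemma A_c_int n alpha (G : graph n) i j : A_c alpha G i j \is a Num.int.
Proof.
have /and3P[_ h1 h2] := c_alphaP alpha.
rewrite /A_c /A_alpha !mxE mulrDr !mulrA; apply: rpredD; apply: rpredM => //.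
- by apply: rpredMn; apply: rpred_nat.
- exact: rpred_nat.
Qed.

Lemma A_c_mul1 n alpha (G : graph n) :
  A_c alpha G *m (const_mx 1 : 'cV_n) =
  (c_alpha alpha)%:R *: \col_i (deg G i)%:R.
Proof.
apply/colP=> i; rewrite -scalemxAl !mxE; congr (_ * _).
under eq_bigr do rewrite !mxE mulr1.
rewrite big_split /= -!mulr_sumr (bigD1 i) //= eqxx mulr1n.
rewrite big1 => [|j /negPf ne]; last by rewrite eq_sym ne mulr0n.
rewrite -natr_sum addr0.
have -> : (\sum_j G i j)%N = deg G i.
  by rewrite /deg -sum1dep_card [RHS]big_mkcond; apply: eq_bigr => j _; case: (G i j).
by rewrite -mulrDl addrC subrK mul1r.
Qed.

Lemma Wtilde_int n alpha (G : graph n) i j :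
  Wtilde alpha G i j \is a Num.int.
Proof.
have /and3P[c0 _ _] := c_alphaP alpha.
rewrite mxE; case: (nat_of_ord j) => [|k] /=; first exact: rpred1.
rewrite exprSr -mulmxA A_c_mul1 -scalemxAr mxE mulrAC divff; last first.
  by rewrite pnatr_eq0 -lt0n.
rewrite mul1r; elim: k i => [|k IH] i.
  by rewrite expr0 mul1mx mxE rpred_nat.
rewrite exprS -mulmxA mxE; apply: rpred_sum => l _.
by apply: rpredM => //; apply: A_c_int.
Qed.

(* By Wtilde_int the entries of Wtilde are integers, so numq recovers them. *)
Definition Wtilde_mod n (alpha : rat) (G : graph n) (p : nat) : 'M['F_p]_n :=
  map_mx (fun x : rat => (numq x)%:~R) (Wtilde alpha G).

Definition squarefree (z : int) : Prop :=
  forall d : int, (d ^+ 2 %| z)%Z -> `|d|%N = 1%N.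

Definition odd_squarefree_integer (x : rat) : Prop :=
  exists z : int, [/\ x = z%:~R, ~~ (2 %| z)%Z & squarefree z].

(* Main.v *)
Require Import Defs.
From mathcomp Require Import all_boot all_order all_algebra all_field.
From mathcomp Require Import ring zify.

Set Implicit Arguments.
Unset Strict Implicit.
Unset Printing Implicit Defensive.

Import Order.TTheory GRing.Theory Num.Theory.
Local Open Scope ring_scope.

(** The matrix A = c A_alpha(G) is integral and symmetric. The two characteristic
polynomials determine the walk counts 1 A^k 1^T, so the walk matrices W, V of G
and H have the same Gram matrix, Q = W^-1 V is orthogonal, fixes 1 and conjugates
A to the matrix of H. Let l be the least positive integer making U = l Q^T integral.
If a prime p divides l, some row u of U is nonzero modulo p while W u^T = 0 mod p
and u A^k u^T = 0 mod p^2 for all k.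
For p odd, either W is invertible modulo p, or det W has p-adic valuation at most 1,
so W has corank at most 1 modulo p; then u is an eigenvector modulo p, and lifting
its expression as a polynomial in A applied to 1 shows that the polynomial is zero.
For p = 2 the vectors d A^k, d the degree vector, span an isotropic space, and
the conditions u A^k u^T = 0 mod 4 become linear in the coefficients of u; as det W
is 2^(n/2) times an odd number, u is 0 or the all-ones vector modulo 2. In the
second case 4 does not divide l, so l = 2 and u u^T = 4 < n, a contradiction.
Hence l = 1 and Q is a permutation matrix. *)

(** * Integer matrices modulo a prime *)

Lemma map_mx_expr (R S : comNzRingType) (f : {rmorphism R -> S}) n (A : 'M[R]_n) k :
  map_mx f (A ^+ k) = map_mx f A ^+ k.
Proof.
elim: k => [|k IH]; first by rewrite !expr0 map_mx1.
by rewrite !exprS map_mxM IH.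
Qed.

Section Reduction.
Variables (p : nat) (p_pr : prime p).

Definition red m n (M : 'M[int]_(m, n)) : 'M['F_p]_(m, n) := map_mx intr M.

Lemma intr_Fp_eq0 (z : int) : (z%:~R == 0 :> 'F_p) = (p %| z)%Z.
Proof. by rewrite (dvdz_pcharf (pchar_Fp p_pr)). Qed.

Lemma redD m n (M N : 'M_(m, n)) : red (M + N) = red M + red N.
Proof. exact: map_mxD. Qed.

Lemma redZ m n a (M : 'M_(m, n)) : red (a *: M) = a%:~R *: red M.
Proof. exact: map_mxZ. Qed.

Lemma redM m n q (M : 'M_(m, n)) (N : 'M_(n, q)) :
  red (M *m N) = red M *m red N.
Proof. exact: map_mxM. Qed.

Lemma redX n (M : 'M_n) k : red (M ^+ k) = red M ^+ k.
Proof. exact: map_mx_expr. Qed.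

Lemma red_tr m n (M : 'M_(m, n)) : red M^T = (red M)^T.
Proof. by rewrite /red map_trmx. Qed.

Lemma redZp m n (M : 'M_(m, n)) : red (p%:Z *: M) = 0.
Proof.
by rewrite redZ (_ : p%:Z%:~R = 0) ?scale0r //; apply/eqP; rewrite intr_Fp_eq0 dvdzz.
Qed.

Lemma red_eq0 m n (M : 'M_(m, n)) : red M = 0 -> exists N, M = p%:Z *: N.
Proof.
move=> M0; exists (\matrix_(i, j) (M i j %/ p)%Z); apply/matrixP=> i j.
rewrite !mxE mulrC divzK // -intr_Fp_eq0.
by move/matrixP/(_ i j): M0; rewrite !mxE => ->.
Qed.

Lemma red_lift m n (N : 'M['F_p]_(m, n)) : exists M, N = red M.
Proof.
exists (\matrix_(i, j) (N i j : nat)%:Z); apply/matrixP=> i j.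
by rewrite !mxE -[RHS]/((N i j : nat)%:R) natr_Zp.
Qed.

Lemma det_red n (M : 'M_n) : \det (red M) = (\det M)%:~R.
Proof. by rewrite /red det_map_mx. Qed.

Lemma rank_red_full n (M : 'M_n) :
  (\rank (red M) == n) = ~~ (p %| \det M)%Z.
Proof.
by rewrite -/(row_free _) row_free_unit unitmxE det_red unitfE intr_Fp_eq0.
Qed.

(* Over F_p some invertible E makes the rows of E M beyond the rank vanish; an
   integral lift of E has determinant prime to p, and these rows of the product
   are divisible by p. *)
Lemma dvdz_det_rank n (M : 'M_n) :
  (p%:Z ^+ (n - \rank (red M)) %| \det M)%Z.
Proof.
set r := \rank _; have [E defE] := red_lift (invmx (col_ebase (red M))).
pose F := E *m M; pose d : 'rV[int]_n := \row_i (if (i < r)%N then 1 else p%:Z).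
have redF (i j : 'I_n) : (r <= i)%N -> (p %| F i j)%Z.
  move=> ri; rewrite -intr_Fp_eq0; apply/eqP.
  have -> : (F i j)%:~R = red F i j by rewrite [RHS]mxE.
  rewrite redM -defE -[X in invmx _ *m X]mulmx_ebase -/r -mulmxA mulKmx ?col_ebase_unit //.
  rewrite mxE big1 // => k _; rewrite !mxE.
  by rewrite [(i < r)%N]ltnNge ri andbF mul0r.
pose F' := \matrix_(i, j) (if (i < r)%N then F i j else (F i j %/ p)%Z).
have FE : F = diag_mx d *m F'.
  apply/matrixP=> i j; rewrite mul_diag_mx [RHS]mxE [d 0 i]mxE [F' i j]mxE; case: ltnP => [_|ri].
    by rewrite mul1r.
  by rewrite mulrC divzK ?redF.
have cE : coprimez (p%:Z ^+ (n - r)) (\det E).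
  rewrite coprimezXl // coprimezE prime_coprime // -[X in ~~ X]/(p %| \det E)%Z.
  rewrite -intr_Fp_eq0 -det_red -defE det_inv invr_eq0.
  by have := col_ebase_unit (red M); rewrite unitmxE unitfE.
rewrite -(Gauss_dvdzr _ cE) -det_mulmx -/F FE det_mulmx det_diag dvdz_mulr //.
have -> : \prod_i d 0 i = \prod_(i < n | (r <= i)%N) p%:Z.
  rewrite [RHS]big_mkcond; apply: eq_bigr => i _; rewrite mxE.
  by case: ltnP.
rewrite prodr_const (_ : #|_| = n - r)%N ?dvdzz //.
have -> : #|[pred i : 'I_n | (r <= i)%N]| = (\sum_(i < n | (r <= i)%N) 1)%N by rewrite sum1_card.
rewrite -(big_mkord (fun i => r <= i)%N (fun=> 1%N)).
have rn : (r <= n)%N by apply: rank_leq_row.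
rewrite (big_cat_nat _ rn) //= big_nat_cond big1 ?add0n; last first.
  by move=> i /andP[/andP[_ h1] h2]; move: h1; rewrite ltnNge h2.
rewrite big_nat_cond (eq_bigl (fun i => (r <= i < n)%N)); last first.
  by move=> i; case: (r <= i)%N; rewrite ?andbT.
by rewrite -big_nat sum_nat_const_nat muln1.
Qed.

End Reduction.

Arguments red p [m n] M.

(** * Krylov matrices *)

Section Krylov.
Variables (R : comNzRingType) (n : nat) (A : 'M[R]_n) (v : 'rV[R]_n).

Definition krylov k : 'M_(k, n) := \matrix_(i < k) (v *m A ^+ i).

Lemma row_krylov k (i : 'I_k) : row i (krylov k) = v *m A ^+ i.
Proof. exact: rowK. Qed.

Lemma mul_krylov k (g : 'rV_k) : g *m krylov k = \sum_i g 0 i *: (v *m A ^+ i).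
Proof. by rewrite mulmx_sum_row; apply: eq_bigr => i _; rewrite row_krylov. Qed.

Lemma mulmx_exprS (u : 'rV[R]_n) k : u *m A ^+ k.+1 = u *m A ^+ k *m A.
Proof. by rewrite exprSr -mulmxA. Qed.

End Krylov.

Lemma red_krylov p n (A : 'M_n) v k :
  red p (krylov A v k) = krylov (red p A) (red p v) k.
Proof.
apply/row_matrixP => i; rewrite row_krylov -redX -redM; apply/rowP => j.
by rewrite !mxE; congr (_%:~R); apply: eq_bigr.
Qed.

Section KrylovField.
Variables (F : fieldType) (n : nat) (A : 'M[F]_n) (v : 'rV[F]_n).

Lemma krylov_sub k i : (i < k)%N -> (v *m A ^+ i <= krylov A v k)%MS.
Proof. by move=> ik; rewrite -(row_krylov A v (Ordinal ik)) row_sub. Qed.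

Lemma krylov_subS k m : (k <= m)%N -> (krylov A v k <= krylov A v m)%MS.
Proof.
move=> km; apply/row_subP => i; rewrite row_krylov krylov_sub //.
exact: leq_trans km.
Qed.

Lemma krylov_stable k :
  (v *m A ^+ k <= krylov A v k)%MS ->
  forall l, (v *m A ^+ l <= krylov A v k)%MS.
Proof.
move=> vk; elim=> [|l IH].
  by case: k vk => [|k] // _; apply: krylov_sub.
rewrite mulmx_exprS; apply: (submx_trans (submxMr A IH)).
apply/row_subP => i; rewrite row_mul row_krylov -mulmx_exprS.
have [->//|ne] := eqVneq i.+1 k.
by apply: krylov_sub; rewrite ltn_neqAle ne ltn_ord.
Qed.

(** If no [v *m A ^+ i] with [i <= r] lay in the span of its predecessors, the rank would grow at
    each step and reach [r + 1]. From the first dependence on, the span is stable under [A]. *)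
Lemma krylov_span r : (\rank (krylov A v r.+1) <= r)%N ->
  forall l, (v *m A ^+ l <= krylov A v r)%MS.
Proof.
move=> rk l; suff [i ir vi] : exists2 i, (i <= r)%N & (v *m A ^+ i <= krylov A v i)%MS.
  by apply: submx_trans (krylov_subS ir); apply: krylov_stable.
case: (pickP (fun i : 'I_r.+1 => v *m A ^+ i <= krylov A v i)%MS) => [i vi|vN].
  by exists i; rewrite // -ltnS.
suff /(_ r.+1 (leqnn _)) H : forall k, (k <= r.+1)%N -> (k <= \rank (krylov A v k))%N.
  by rewrite leqNgt ltnS rk in H.
elim=> // k IH kr; have /leq_ltn_trans -> // := IH (ltnW kr).
rewrite (ltn_leqif (mxrank_leqif_sup (krylov_subS (leqnSn k)))).
apply: contraFN (vN (Ordinal kr)) => /= /(submx_trans _) -> //.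
exact: krylov_sub.
Qed.

End KrylovField.

Lemma mul_krylov_horner (R : comNzRingType) r (A : 'M[R]_r.+1) v k (g : 'rV_k) :
  g *m krylov A v k = v *m horner_mx A (rVpoly g).
Proof.
rewrite mul_krylov [in RHS](row_sum_delta g) linear_sum rmorph_sum mulmx_sumr.
apply: eq_bigr => i _; rewrite linearZ /= rVpoly_delta linearZ /= rmorphXn /=.
by rewrite horner_mx_X -scalemxAr.
Qed.

Lemma intr_Fp_surj p (a : 'F_p) : exists z : int, a = z%:~R.
Proof. by exists (a : nat)%:Z; rewrite -[RHS]/((a : nat)%:R) natr_Zp. Qed.

Lemma scalemx_intK m n (a : int) : a != 0 -> injective (fun M : 'M[int]_(m, n) => a *: M).
Proof.
move=> a0 M N /matrixP MN; apply/matrixP => i j; apply: (mulfI a0).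
by have := MN i j; rewrite !mxE.
Qed.

(* If u = g(A)v mod p, then the vector s below is orthogonal to u modulo p, hence
   equals b(A)v mod p, and ((X - a) g - p b)(A)v vanishes modulo p^2; the adjugate
   of the Krylov matrix then forces (X - a) g = 0 mod p. *)
Lemma krylov_orthogonal_eq0 p r (A : 'M[int]_r.+1) (v u : 'rV_r.+1) (z0 z1 : 'M_1) :
  prime p -> A^T = A -> ~~ (p%:Z ^+ 2 %| \det (krylov A v r.+1))%Z ->
  red p (u *m (krylov A v r.+1)^T) = 0 ->
  u *m u^T = p%:Z ^+ 2 *: z0 -> u *m A *m u^T = p%:Z ^+ 2 *: z1 ->
  red p u = 0.
Proof.
move=> p_pr symA ndet uK uu uAu; have [//|u0] := eqVneq (red p u) 0.
have p0 : p%:Z != 0 by rewrite -lt0n prime_gt0.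
set K := krylov A v r.+1 in ndet uK *; set K' := red p K; set w := red p u in u0 *.
set A' := red p A; set v' := red p v.
have K'E : K' = krylov A' v' r.+1 by apply: red_krylov.
have symA' : A'^T = A' by rewrite /A' -red_tr symA.
rewrite redM red_tr -/K' -/w in uK.
have Ku : K' *m w^T = 0 by rewrite -[LHS]trmxK trmx_mul trmxK uK trmx0.
have rw : \rank w^T = 1%N by rewrite mxrank_tr rank_rV u0.
(* As p^2 does not divide the determinant, the corank is at most 1; the nonzero kernel vector [w]
   makes it exactly 1. *)
have rK : \rank K' = r.
  apply/eqP; rewrite eqn_leq -ltnS -addn1 -{1}rw (mulmx0_rank_max Ku) /=.
  rewrite leqNgt; apply: contra ndet => rK.
  apply: dvdz_trans (dvdz_det_rank p_pr K); rewrite -/K'.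
  by apply: dvdz_exp2l; rewrite -(leq_add2r (\rank K')) subnK ?rank_leq_row.
have span l : (v' *m A' ^+ l <= krylov A' v' r)%MS.
  by apply: krylov_span; rewrite -K'E rK.
have K'r : (K' <= krylov A' v' r)%MS.
  by rewrite K'E; apply/row_subP => i; rewrite row_krylov.
have kerw : (kermx w^T <= krylov A' v' r)%MS.
  apply: submx_trans K'r; have /mxrank_leqif_sup/leqifP : (K' <= kermx w^T)%MS by apply/sub_kermxP.
  by case: ifP => // _; rewrite mxrank_ker rw rK subn1 ltnn.
(* By dimension [w] spans the orthogonal complement of the row space of [K']. The symmetric [A']
   preserves that row space, hence also its complement. *)
have wA : (w *m A' <= w)%MS.
  have kerK : (kermx K'^T <= w)%MS.
    have /mxrank_leqif_sup/leqifP : (w <= kermx K'^T)%MS by apply/sub_kermxP.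
    by case: ifP => // _; rewrite mxrank_ker mxrank_tr rank_rV u0 rK subSnn.
  apply: submx_trans kerK; apply/sub_kermxP.
  have /submxP[D DE] : (K' *m A' <= K')%MS.
    apply/row_subP => i; rewrite row_mul {1}K'E row_krylov -mulmx_exprS.
    apply: submx_trans (span _) _; rewrite K'E; exact: krylov_subS.
  by apply: trmx_inj; rewrite !trmx_mul trmxK symA' mulmxA DE -mulmxA Ku mulmx0 trmx0.
have {wA} [a' wA] := sub_rVP wA; have [a aE] := intr_Fp_surj a'.
have ww : w *m w^T = 0 by rewrite /w -red_tr -redM uu expr2 -scalerA redZp.
have : (w <= krylov A' v' r)%MS by apply: submx_trans kerw; apply/sub_kermxP.
case/submxP => g' wE; have [g gE] := red_lift g'.
pose y := g *m krylov A v r.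
have yE : red p y = w by rewrite redM red_krylov -gE.
have [t tE] : exists t, u - y = p%:Z *: t.
  by apply: (red_eq0 p_pr); rewrite redD -scaleN1r redZ yE scaleN1r subrr.
have [q qE] : exists q, u *m A - a *: u = p%:Z *: q.
  by apply: (red_eq0 p_pr); rewrite redD -scaleNr redZ redM -/w wA aE rmorphN scaleNr subrr.
have [s sE] : exists s, y *m A - a *: y = p%:Z *: s.
  by apply: (red_eq0 p_pr); rewrite redD -scaleNr redZ redM yE wA aE rmorphN scaleNr subrr.
(* Write [y = u - p t]. Symmetry moves [A - a] from [t] to [u], where it gives [p q]; since [u u^T]
   and [u A u^T] vanish modulo p^2, one factor p survives after the division by p. *)
have su : s *m u^T = p%:Z *: (z1 - a *: z0 - t *m q^T).
  apply: (scalemx_intK p0); rewrite /= scalemxAl -sE.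
  have -> : y *m A - a *: y = (u *m A - a *: u) - p%:Z *: (t *m A - a *: t).
    have -> : y = u - p%:Z *: t by rewrite -tE opprB addrC subrK.
    rewrite mulmxBl scalerBr opprB -scalemxAl scalerBr opprB !scalerA [a * _]mulrC.
    by rewrite addrACA [RHS]addrACA; congr (_ + _); rewrite addrC.
  have tq : (t *m A - a *: t) *m u^T = p%:Z *: (t *m q^T).
    rewrite mulmxBl -mulmxA -scalemxAl [a *: _]scalemxAr -mulmxBr scalemxAr.
    congr (_ *m _); have -> : p%:Z *: q^T = (p%:Z *: q)^T by rewrite linearZ.
    by rewrite -qE raddfB /= trmx_mul symA [(a *: u)^T]linearZ.
  rewrite mulmxBl -scalemxAl tq mulmxBl uAu -scalemxAl uu !scalerBr !scalerA expr2.
  by rewrite [a * _]mulrC.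
have : (red p s <= krylov A' v' r)%MS.
  by apply: submx_trans kerw; apply/sub_kermxP; rewrite -red_tr -redM su redZp.
case/submxP => b' sb; have [b bE] := red_lift b'.
have [q2 q2E] : exists q2, s - b *m krylov A v r = p%:Z *: q2.
  apply: (red_eq0 p_pr); rewrite redD -scaleN1r redZ redM red_krylov -bE -sb.
  by rewrite scaleN1r subrr.
(* Its degree is at most [r], so its coefficients form a row that can multiply the Krylov matrix
   [K]. *)
pose f := rVpoly g * ('X - a%:P) - p%:Z *: rVpoly b.
have vf : v *m horner_mx A f = p%:Z ^+ 2 *: q2.
  rewrite expr2 -scalerA -q2E scalerBr -sE /y !mul_krylov_horner.
  rewrite rmorphB /= [horner_mx A (_ *: _)]linearZ /= rmorphM rmorphB /= horner_mx_X horner_mx_C.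
  by rewrite mulmxBr -scalemxAr mulmxA mulmxBr mul_mx_scalar.
have sz_rV k (c : 'rV[int]_k) : (size (rVpoly c) <= k)%N by apply: size_poly.
have szf : (size f <= r.+1)%N.
  apply: leq_trans (size_polyD _ _) _; rewrite geq_max size_polyN.
  rewrite (leq_trans (size_scale_leq _ _)) ?(leq_trans (sz_rV _ _)) // andbT.
  apply: leq_trans (size_polyMleq _ _) _; rewrite size_XsubC addn2 /=.
  exact: sz_rV.
pose F := poly_rV f : 'rV_r.+1.
have FK : F *m K = p%:Z ^+ 2 *: q2 by rewrite mul_krylov_horner poly_rV_K.
have [m detK] : exists m, \det K = m * p%:Z.
  apply/dvdzP; move: (rank_red_full p_pr K); rewrite -/K' rK.
  by case: (p %| _)%Z => //; rewrite eqn_leq ltnn andbF.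
have m0 : m%:~R != 0 :> 'F_p.
  by rewrite intr_Fp_eq0 //; apply: contra ndet => pm; rewrite detK expr2 dvdz_mul.
(* The adjugate turns [F K] into [m p F]. Only one factor p is lost against the p^2 on the right, so
   [F] vanishes modulo p. *)
have : m *: F = p%:Z *: (q2 *m \adj K).
  apply: (scalemx_intK p0); rewrite /= !scalerA [p%:Z * m]mulrC -detK -expr2.
  by rewrite -mul_mx_scalar -mul_mx_adj mulmxA FK scalemxAl.
move=> E; have := congr1 (fun M => red p M) E; rewrite /= redZp // redZ => /eqP.
rewrite scaler_eq0 (negPf m0) /= => /eqP F0.
have : map_poly intr f = 0 :> {poly 'F_p}.
  by rewrite -[f](poly_rV_K szf) map_rVpoly -/(red p (poly_rV f)) F0 linear0.
rewrite rmorphB rmorphM rmorphB /= map_polyZ /= map_polyX map_polyC /= => /eqP.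
have -> : p%:~R = 0 :> 'F_p by apply/eqP; rewrite intr_Fp_eq0.
rewrite scale0r subr0 mulf_eq0 polyXsubC_eq0 orbF map_rVpoly -/(red p g) => /eqP g0.
by rewrite wE gE -(rVpolyK (red p g)) g0 linear0 mul0mx.
Qed.

(** * Walk forms *)

Section Moment.
Variables (R : comNzRingType) (n : nat) (A : 'M[R]_n).
Implicit Types x y z : 'rV[R]_n.

(** For all-ones [x] and [y] this is a weighted count of walks of length [l]. *)
Definition moment l x y : R := (x *m A ^+ l *m y^T) 0 0.

Lemma momentDl l x y z : moment l (x + y) z = moment l x z + moment l y z.
Proof. by rewrite /moment !mulmxDl mxE. Qed.

Lemma momentDr l x y z : moment l x (y + z) = moment l x y + moment l x z.
Proof. by rewrite /moment raddfD /= mulmxDr mxE. Qed.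

Lemma momentZl l a x y : moment l (a *: x) y = a * moment l x y.
Proof. by rewrite /moment -!scalemxAl mxE. Qed.

Lemma momentZr l a x y : moment l x (a *: y) = a * moment l x y.
Proof. by rewrite /moment linearZ /= -scalemxAr mxE. Qed.

Lemma moment_suml l I (s : seq I) (f : I -> 'rV_n) y :
  moment l (\sum_(i <- s) f i) y = \sum_(i <- s) moment l (f i) y.
Proof. by rewrite /moment !mulmx_suml summxE. Qed.

Lemma moment_sumr l I (s : seq I) x (f : I -> 'rV_n) :
  moment l x (\sum_(i <- s) f i) = \sum_(i <- s) moment l x (f i).
Proof. by rewrite /moment linear_sum mulmx_sumr summxE. Qed.

Lemma moment_expl l i x y : moment l (x *m A ^+ i) y = moment (i + l) x y.
Proof. by rewrite /moment -[x *m _ *m _]mulmxA -[A ^+ i *m _]exprD. Qed.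

Lemma momentE0 x y : moment 0 x y = \sum_i x 0 i * y 0 i.
Proof. by rewrite /moment expr0 mulmx1 mxE; apply: eq_bigr => i _; rewrite mxE. Qed.

Hypothesis symA : A^T = A.

Lemma trmx_expr i : (A ^+ i)^T = A ^+ i.
Proof.
by elim: i => [|i IH]; rewrite ?expr0 ?trmx1 // [in LHS]exprSr trmx_mul IH symA exprS.
Qed.

Lemma momentC l x y : moment l x y = moment l y x.
Proof.
rewrite /moment.
have -> : (x *m A ^+ l *m y^T) 0 0 = (x *m A ^+ l *m y^T)^T 0 0 by rewrite [RHS]mxE.
by rewrite !trmx_mul trmxK trmx_expr mulmxA.
Qed.

Lemma moment_expr l i x y : moment l x (y *m A ^+ i) = moment (i + l) x y.
Proof. by rewrite momentC moment_expl momentC. Qed.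

Lemma krylov_gram x y k m (i : 'I_k) (j : 'I_m) :
  (krylov A x k *m (krylov A y m)^T) i j = moment (i + j) x y.
Proof.
have -> : (krylov A x k *m (krylov A y m)^T) i j =
    moment 0 (row i (krylov A x k)) (row j (krylov A y m)).
  by rewrite momentE0 mxE; apply: eq_bigr => l _; rewrite !mxE.
by rewrite !row_krylov moment_expl moment_expr addn0 addnC.
Qed.

End Moment.

Lemma moment_map (R S : comNzRingType) (f : {rmorphism R -> S}) n (A : 'M[R]_n) l x y :
  moment (map_mx f A) l (map_mx f x) (map_mx f y) = f (moment A l x y).
Proof. by rewrite /moment -map_mx_expr map_trmx -!map_mxM mxE. Qed.

Lemma moment_red p n (A : 'M_n) l x y :
  moment (red p A) l (red p x) (red p y) = (moment A l x y)%:~R.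
Proof. exact: moment_map. Qed.

(** The moments are the Gram entries of the Krylov rows, so these span an isotropic space, whose
    dimension is at most [n./2]; then [krylov_span] applies. *)
Lemma krylov_isotropic (F : fieldType) n (A : 'M[F]_n) v :
  A^T = A -> (forall l, moment A l v v = 0) ->
  forall l, (v *m A ^+ l <= krylov A v n./2)%MS.
Proof.
move=> symA iso; apply: krylov_span; set K := krylov A v _.
have /mulmx0_rank_max : K *m K^T = 0.
  by apply/matrixP => i j; rewrite krylov_gram // iso mxE.
by rewrite mxrank_tr; lia.
Qed.

(** * Quadratic forms modulo 4 *)

Lemma red2_eq0 m n (M : 'M[int]_(m, n)) :
  red 2 M = 0 <-> forall i j, (2 %| M i j)%Z.
Proof.
split=> [/matrixP M0 i j|M0].
  by rewrite -(@intr_Fp_eq0 2) //; have := M0 i j; rewrite !mxE => ->.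
by apply/matrixP => i j; apply/eqP; rewrite !mxE intr_Fp_eq0.
Qed.

Lemma sum_symmetric (V : zmodType) h (g : 'I_h -> 'I_h -> V) :
  (forall i j, g i j = g j i) ->
  \sum_i \sum_j g i j = \sum_i g i i + (\sum_(i < h) \sum_(j < h | (j < i)%N) g i j) *+ 2.
Proof.
move=> gC.
have E (i : 'I_h) : \sum_j g i j =
    g i i + (\sum_(j < h | (j < i)%N) g i j + \sum_(j < h | (i < j)%N) g i j).
  rewrite (bigD1 i) //=; congr (_ + _).
  rewrite (bigID (fun j : 'I_h => (j < i)%N)) /=; congr (_ + _); apply: eq_bigl => j.
    by case: ltngtP => ji; rewrite ?andbF // andbT; apply/eqP => E; rewrite E ltnn in ji.
  rewrite -leqNgt [(i <= j)%N]leq_eqVlt -(inj_eq val_inj) eq_sym.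
  by case: eqVneq => //= ->; rewrite ltnn.
rewrite (eq_bigr _ (fun i _ => E i)) !big_split /= mulr2n; congr (_ + (_ + _)).
rewrite (exchange_big_dep predT) //=; apply: eq_bigr => i _.
by apply: eq_bigr => j _.
Qed.

Lemma dvd2_mul_pred (x : int) : (2 %| x * (x - 1))%Z.
Proof.
have [t [->|->]] : exists t, x = 2 * t \/ x = 2 * t + 1 by exists (x %/ 2)%Z; lia.
  by rewrite -mulrA dvdz_mulr.
by rewrite addrK dvdz_mull // dvdz_mulr.
Qed.

(** Off-diagonal terms are even and occur in pairs. On the diagonal [a i * (a i - 1)] and [f i i]
    are both even. So modulo 4 the quadratic form is linear in [a]. *)
Lemma dvdz_quadratic4 h (a : 'I_h -> int) (f : 'I_h -> 'I_h -> int) :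
  (forall i j, f i j = f j i) -> (forall i j, (2 %| f i j)%Z) ->
  (4 %| \sum_i \sum_j a i * a j * f i j - \sum_i a i * f i i)%Z.
Proof.
move=> fC f2; rewrite sum_symmetric; last by move=> i j; rewrite fC; ring.
rewrite addrAC -sumrB; apply: rpredD.
  apply: rpred_sum => i _; have /dvdzP[q ->] := f2 i i.
  have /dvdzP[t tE] := dvd2_mul_pred (a i); apply/dvdzP; exists (q * t).
  by transitivity (a i * (a i - 1) * q * 2); [ring | rewrite tE; ring].
rewrite -mulr_natr.
have /dvdzP[q ->] : (2 %| \sum_(i < h) \sum_(j < h | (j < i)%N) a i * a j * f i j)%Z.
  by apply: rpred_sum => i _; apply: rpred_sum => j _; apply: dvdz_mull.
by apply/dvdzP; exists q; ring.
Qed.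

Section ModFour.
Variables (n : nat) (A : 'M[int]_n).
Hypothesis symA : A^T = A.

Lemma moment_mod4 l (y t : 'rV_n) :
  (4 %| moment A l (y + 2 *: t) (y + 2 *: t) - moment A l y y)%Z.
Proof.
rewrite !(momentDl, momentDr, momentZl, momentZr) [moment A l t y]momentC //.
by apply/dvdzP; exists (moment A l y t + moment A l t t); ring.
Qed.

Lemma moment_krylov_mod4 l h (v : 'rV_n) (a : nat -> int) :
  (forall m, (2 %| moment A m v v)%Z) ->
  let y := \sum_(i < h) a i *: (v *m A ^+ i) in
  (4 %| moment A l y y - \sum_(i < h) a i * moment A (i.*2 + l) v v)%Z.
Proof.
move=> ev; set y := \sum_(i < h) _; rewrite /= {1}/y moment_suml.
have -> : \sum_(i < h) moment A l (a i *: (v *m A ^+ i)) y =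
  \sum_(i < h) \sum_(j < h) a i * a j * moment A (i + j + l) v v.
  apply: eq_bigr => i _; rewrite moment_sumr; apply: eq_bigr => j _.
  by rewrite momentZl momentZr moment_expl moment_expr // mulrA [(i + j)%N]addnC addnA.
under [in X in _ - X]eq_bigr do rewrite -addnn.
apply: (@dvdz_quadratic4 h (fun i => a i) (fun i j => moment A (i + j + l) v v)) => // i j.
by rewrite [(i + j)%N]addnC.
Qed.

End ModFour.

Lemma dvd4_mul (x y : int) : (2 %| x)%Z -> (2 %| y)%Z -> (4 %| x * y)%Z.
Proof. exact: (@dvdz_mul 2 2). Qed.

Lemma intr_F2_odd (z : int) : ~~ (2 %| z)%Z -> z%:~R = 1 :> 'F_2.
Proof.
move=> z2; have -> : z = 2 * (z %/ 2)%Z + 1 by lia.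
by rewrite rmorphD rmorphM /= (_ : 2%:~R = 0) ?mul0r ?add0r //; apply/eqP.
Qed.

(** The lifted coefficients are indexed by [nat] so that they can later be moved to other
    positions. *)
Lemma red_krylov_lift p n (A : 'M_n) (v u : 'rV_n) h (g' : 'rV_h) : prime p ->
  red p u = g' *m krylov (red p A) (red p v) h ->
  exists (a : nat -> int) (t : 'rV_n), (forall i : 'I_h, g' 0 i = (a i)%:~R) /\
    u = \sum_(i < h) a i *: (v *m A ^+ i) + p%:Z *: t.
Proof.
move=> p_pr gE; have [g defg] := red_lift g'.
have [t tE] : exists t, u - g *m krylov A v h = p%:Z *: t.
  apply: (red_eq0 p_pr).
  by rewrite redD -scaleN1r redZ redM red_krylov -defg -gE scaleN1r subrr.
exists (fun i => (rVpoly g)`_i), t; split=> [i|].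
  by rewrite coef_rVpoly_ord defg mxE.
rewrite -tE mul_krylov; under eq_bigr do rewrite coef_rVpoly_ord.
by rewrite addrC subrK.
Qed.

Lemma sum_even_ord (V : nmodType) k (f : nat -> V) :
  \sum_(j < k) (if odd j then 0 else f j) = \sum_(i < uphalf k) f i.*2.
Proof.
elim: k => [|k IH]; first by rewrite !big_ord0.
rewrite big_ord_recr /= IH uphalf_half; case: ifP => ok; rewrite ?addr0 ?add0n //.
by rewrite big_ord_recr /= -[in f k](odd_double_half k) ok.
Qed.

(* The vector spreading the coefficients a over the even positions is annihilated
   modulo 2 by the halved Gram matrix, because u A^l u^T = 0 mod 4. *)
Lemma half_krylov_eq0 n k (A : 'M_n) (v u : 'rV_n) (P : 'M_k) :
  A^T = A -> (forall m, (2 %| moment A m v v)%Z) ->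
  krylov A v k *m (krylov A v k)^T = 2 *: P -> ~~ (2 %| \det P)%Z ->
  (forall l, (4 %| moment A l u u)%Z) ->
  (red 2 u <= krylov (red 2 A) (red 2 v) (uphalf k))%MS -> red 2 u = 0.
Proof.
move=> symA ev gram detP u4 /submxP[g /red_krylov_lift[//|a [t [_ uE]]]].
set y := \sum_(i < _) _ in uE.
pose Y : 'rV_k := \row_j (if odd j then 0 else a j./2).
have PE (j l : 'I_k) : 2 * P j l = moment A (j + l) v v.
  by move/matrixP/(_ j l): gram; rewrite krylov_gram // mxE.
have YP : red 2 (Y *m P) = 0.
  apply/red2_eq0 => i l; rewrite {i}ord1.
  have : (4 %| \sum_(i < uphalf k) a i * moment A (i.*2 + l) v v)%Z.
    rewrite -(rpredDl _ (moment_krylov_mod4 symA l (uphalf k) a ev)) subrK.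
    by rewrite -(rpredDl _ (moment_mod4 symA l y t)) subrK -uE.
  have -> : \sum_(i < uphalf k) a i * moment A (i.*2 + l) v v = 2 * (Y *m P) 0 l.
    rewrite mxE mulr_sumr.
    rewrite (eq_bigr (fun j : 'I_k => if odd j then 0 else a j./2 * moment A (j + l) v v)).
      rewrite (sum_even_ord _ (fun j => a j./2 * moment A (j + l) v v)).
      by under [RHS]eq_bigr do rewrite doubleK.
    by move=> j _; rewrite mxE mulrCA PE; case: ifP; rewrite ?mul0r.
  by rewrite (@dvdz_mul2l 2 2).
have Y0 : red 2 Y = 0.
  have uP : red 2 P \in unitmx by rewrite unitmxE det_red unitfE intr_Fp_eq0.
  by rewrite -[red 2 Y](mulmxK uP) -redM YP mul0mx.
rewrite uE redD redZp // addr0 /y; apply/red2_eq0 => i j.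
rewrite summxE; apply: rpred_sum => s _; rewrite mxE dvdz_mulr //.
have sk : (s.*2 < k)%N by have := ltn_ord s; lia.
move/red2_eq0/(_ 0 (Ordinal sk)): Y0.
by rewrite mxE /= odd_double doubleK.
Qed.

(** * Walk matrices and their Gram matrices *)

Lemma gram_solve n (W P : 'M[int]_n) (D : 'rV_n) (u : 'rV_n) (z : 'cV_n) :
  \det W != 0 -> W *m W^T = diag_mx D *m P -> W *m u^T = diag_mx D *m z ->
  \det P *: u = (\adj P *m z)^T *m W.
Proof.
move=> W0 gram Wu; apply: trmx_inj; rewrite trmx_mul trmxK [LHS]linearZ /=.
(* Cancelling [W] on the left through its adjugate reduces the claim to an identity whose two sides
   equal [det P D z]. *)
apply: (scalemx_intK W0); rewrite /= -!mul_scalar_mx -mul_adj_mx -!mulmxA; congr (_ *m _).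
rewrite [RHS]mulmxA gram -mulmxA [P *m _]mulmxA mul_mx_adj !mul_scalar_mx.
by rewrite -!scalemxAr Wu.
Qed.

(** When [v A = c d], row [i > 0] is [v A^i / c]. Starting from [d] avoids the division, so the
    matrix can also be reduced modulo primes dividing [c]. *)
Definition walk (R : comNzRingType) n (A : 'M[R]_n) (v d : 'rV[R]_n) k : 'M_(k, n) :=
  \matrix_(i < k) (if (i : nat) is j.+1 then d *m A ^+ j else v).

Lemma red_walk p n (A : 'M_n) v d k :
  red p (walk A v d k) = walk (red p A) (red p v) (red p d) k.
Proof.
apply/row_matrixP => i; rewrite rowK; transitivity (red p (row i (walk A v d k))).
  by apply/rowP => j; rewrite !mxE.
by rewrite rowK; case: (i : nat) => // j; rewrite redM redX.
Qed.

Lemma mul_walk (R : comNzRingType) n (A : 'M[R]_n) v d k (g : 'rV_k.+1) :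
  g *m walk A v d k.+1 = g 0 0 *: v + (\row_i g 0 (lift 0 i)) *m krylov A d k.
Proof.
rewrite mulmx_sum_row big_ord_recl rowK mul_krylov; congr (_ + _).
by apply: eq_bigr => i _; rewrite rowK mxE.
Qed.

Lemma walk_gram (R : comNzRingType) n (A : 'M[R]_n) v d k (i j : 'I_k) : A^T = A ->
  (walk A v d k *m (walk A v d k)^T) i j =
  match (i : nat), (j : nat) with
  | 0%N, 0%N => moment A 0 v v
  | 0%N, s.+1 => moment A s v d
  | s.+1, 0%N => moment A s v d
  | s.+1, t.+1 => moment A (s + t) d d
  end.
Proof.
move=> symA; have -> : (walk A v d k *m (walk A v d k)^T) i j =
    moment A 0 (row i (walk A v d k)) (row j (walk A v d k)).
  by rewrite momentE0 mxE; apply: eq_bigr => l _; rewrite !mxE.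
rewrite !rowK; case: (i : nat) (j : nat) => [|s] [|t] //.
- by rewrite moment_expr // addn0.
- by rewrite moment_expl addn0 momentC.
- by rewrite moment_expl moment_expr // addn0 addnC.
Qed.

Lemma krylov_walk r (R : comNzRingType) (A : 'M[R]_r.+1) v d c :
  v *m A = c *: d ->
  krylov A v r.+1 = diag_mx (\row_i (if i == 0 then 1 else c)) *m walk A v d r.+1.
Proof.
move=> vA; set e := \row_i _; apply/row_matrixP => i; rewrite row_krylov; apply/rowP => j.
rewrite mul_diag_mx [RHS]mxE [RHS]mxE [e 0 i]mxE [walk A v d r.+1 i j]mxE.
case: (unliftP 0 i) => [i' ->|->] /=; last by rewrite expr0 mulmx1 mul1r.
by rewrite exprS mulmxA vA -scalemxAl mxE.
Qed.

Lemma det_krylov_walk r (R : comNzRingType) (A : 'M[R]_r.+1) v d c :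
  v *m A = c *: d -> \det (krylov A v r.+1) = c ^+ r * \det (walk A v d r.+1).
Proof.
move=> vA; rewrite (krylov_walk vA) det_mulmx det_diag big_ord_recl mxE eqxx mul1r.
congr (_ * _).
by rewrite (eq_bigr (fun=> c)) ?prodr_const ?card_ord // => i _; rewrite mxE.
Qed.

Lemma sum_ord3 (V : nmodType) (f : 'I_3 -> V) : \sum_i f i = f 0 + (f 1 + f 2).
Proof.
rewrite !big_ord_recl big_ord0 addr0.
by congr (f _ + (f _ + f _)); apply: val_inj.
Qed.

(** At most two columns of [w *m P] are nonzero and [P] is invertible, so [w] has rank at most 2 and
    its three rows are dependent. *)
Lemma dependent_rank2 (F : fieldType) n (P : 'M[F]_n) (w : 'M_(3, n)) :
  P \in unitmx -> (forall i (j : 'I_n), (1 < j)%N -> (w *m P) i j = 0) ->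
  exists2 x : 'rV_3, x != 0 & x *m w = 0.
Proof.
move=> uP wP; have E : w *m P = w *m P *m (pid_mx 2 : 'M_n).
  apply/matrixP => i j; rewrite [RHS]mxE (bigD1 j) //= [pid_mx 2 j j]mxE eqxx /=.
  rewrite big1 ?addr0 => [|k kj]; last first.
    by rewrite [pid_mx 2 k j]mxE (inj_eq val_inj) (negPf kj) mulr0.
  by case: ltnP => j2; rewrite ?mulr1 // mulr0 wP.
have rw : (\rank w <= 2)%N.
  rewrite -(mxrankMfree w (B := P)) ?row_free_unit // E.
  have -> : (pid_mx 2 : 'M[F]_n) = (pid_mx 2 : 'M_(n, 2)) *m (pid_mx 2 : 'M_(2, n)).
    by rewrite mul_pid_mx minnn.
  by rewrite mulmxA; apply: mulmx_max_rank.
have /rowV0Pn[x /sub_kermxP xw x0] : kermx w != 0.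
  by rewrite -mxrank_eq0 mxrank_ker; lia.
by exists x.
Qed.

(** * The primes dividing the level *)

Section ModTwo.
Variables (r : nat) (A : 'M[int]_r.+1) (d : 'rV[int]_r.+1) (c a m : int).
Local Notation n := r.+1.
Local Notation v := (const_mx 1 : 'rV[int]_r.+1).
Local Notation W := (walk A v d n).
Hypothesis symA : A^T = A.
Hypothesis vA : v *m A = c *: d.
Hypothesis diagA : forall i, A i i = a * d 0 i.
Hypothesis even_deg : (2 %| moment A 0 v d)%Z.
Hypothesis detW : \det W = 2 ^+ n./2 * m.
Hypothesis m_odd : ~~ (2 %| m)%Z.

Lemma momentS_ones l y : moment A l.+1 v y = c * moment A l d y.
Proof. by rewrite /moment exprS mulmxA vA -!scalemxAl mxE. Qed.

Lemma moment0_ones (y : 'rV[int]_n) : (2 %| moment A 0 y y - moment A 0 v y)%Z.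
Proof.
rewrite !momentE0 -sumrB; apply: rpred_sum => i _; rewrite mxE.
have -> : y 0 i * y 0 i - 1 * y 0 i = y 0 i * (y 0 i - 1) by ring.
exact: dvd2_mul_pred.
Qed.

(** Modulo 2 the off-diagonal terms of [y A y^T] cancel in pairs, and on the diagonal [y_i^2] agrees
    with [y_i]. *)
Lemma moment1_diag (y : 'rV[int]_n) : (2 %| moment A 1 y y - a * moment A 0 d y)%Z.
Proof.
have -> : moment A 1 y y = \sum_i \sum_j y 0 i * A i j * y 0 j.
  rewrite /moment expr1 mxE exchange_big /=; apply: eq_bigr => j _.
  by rewrite !mxE mulr_suml; apply: eq_bigr.
rewrite sum_symmetric; last first.
  by move=> i j; rewrite -[in RHS]symA [in RHS]mxE mulrAC [RHS]mulrAC [y 0 i * _]mulrC.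
rewrite addrAC; apply: rpredD; last by rewrite -[X in X \in _]mulr_natr dvdz_mull.
rewrite momentE0 mulr_sumr -sumrB; apply: rpred_sum => i _; rewrite diagA.
have -> : y 0 i * (a * d 0 i) * y 0 i - a * (d 0 i * y 0 i) =
    a * d 0 i * (y 0 i * (y 0 i - 1)) by ring.
exact/dvdz_mull/dvd2_mul_pred.
Qed.

(** Strong induction, splitting [A^k] symmetrically around [y = d A^(k/2)]. For odd [k] the value is
    [a d y^T] modulo 2, a moment of lower order; for even [k] it is [1 y^T], which is [even_deg] or
    [c] times a moment of lower order. *)
Lemma even_moment_deg k : (2 %| moment A k d d)%Z.
Proof.
elim/ltn_ind: k => k IH; pose y := d *m A ^+ k./2.
have -> : moment A k d d = moment A (odd k) y y.
  by rewrite moment_expl moment_expr // addnA addnn addnC odd_double_half.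
case ok: (odd k) => /=.
  rewrite -(@rpredBr _ _ (a * moment A 0 d y)) ?moment1_diag // dvdz_mull // moment_expr // addn0.
  by apply: IH; lia.
rewrite -(@rpredBr _ _ (moment A 0 v y)) ?moment0_ones // moment_expr // addn0.
case hk: k./2 => [|h] //; rewrite momentS_ones dvdz_mull //; apply: IH; lia.
Qed.

Lemma even_moment_ones_deg k : (2 %| moment A k v d)%Z.
Proof. by case: k => [|k] //; rewrite momentS_ones dvdz_mull // even_moment_deg. Qed.

Lemma moment0_ones_ones : moment A 0 v v = n%:Z.
Proof.
rewrite momentE0 (eq_bigr (fun=> 1)) ?sumr_const ?card_ord ?natz // => i _.
by rewrite !mxE mulr1.
Qed.

(** All Gram entries of [W] are even except, for odd [n], the corner [1 1^T = n]; hence no factor 2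
    is taken from that row. *)
Let D : 'rV[int]_n := \row_i (if odd n && (i == 0) then 1 else 2).

(** The determinant of [D] is exactly the power of 2 in the square of [det W], which leaves
    [det P = m^2]. *)
Lemma walk_gram_diag : exists P, W *m W^T = diag_mx D *m P /\ ~~ (2 %| \det P)%Z.
Proof.
pose P := \matrix_(i, j) ((W *m W^T) i j %/ D 0%R i)%Z.
have gram : W *m W^T = diag_mx D *m P.
  apply/matrixP => i j; rewrite mul_diag_mx [RHS]mxE [P i j]mxE mulrC divzK //.
  rewrite [D 0 i]mxE walk_gram //; case: (unliftP 0 i) => [i' ->|->] /=.
    rewrite andbF; case: (j : nat) => [|t]; rewrite ?even_moment_deg //.
    exact: even_moment_ones_deg.
  rewrite andbT; case: ifP => // on; case: (j : nat) => [|t]; last exact: even_moment_ones_deg.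
  by rewrite moment0_ones_ones; move: on; lia.
exists P; split=> //.
have detD : \det (diag_mx D) = 2 ^+ (n./2.*2).
  rewrite det_diag big_ord_recl mxE eqxx andbT.
  rewrite (eq_bigr (fun=> 2)) ?prodr_const ?card_ord; last by move=> i _; rewrite mxE andbF.
  case: ifP => on; last rewrite -exprS; rewrite ?mul1r; congr (_ ^+ _); lia.
have E : 2 ^+ (n./2.*2) * \det P = 2 ^+ (n./2.*2) * (m * m).
  by rewrite -detD -det_mulmx -gram det_mulmx det_tr detW detD -addnn exprD; ring.
have /mulfI/(_ _ _ E) -> : 2 ^+ (n./2.*2) != 0 :> int by rewrite expf_eq0 andbF.
by rewrite -(@intr_Fp_eq0 2) // rmorphM /= intr_F2_odd.
Qed.

Lemma det_walk_neq0 : \det W != 0.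
Proof.
by rewrite detW mulf_neq0 ?expf_eq0 ?andbF //; apply: contra m_odd => /eqP ->.
Qed.

(* The factor P of the Gram matrix W W^T = D P has odd determinant, so solving for
   the coordinates of u in the rows of W introduces only odd denominators. *)
Lemma red2_walk_coord u y : W *m u^T = 2 *: y ->
  exists x : 'rV_n, red 2 u = red 2 x *m red 2 W /\ (odd n -> (2 %| x 0%R 0%R)%Z).
Proof.
have [P [gram detP]] := walk_gram_diag => Wu.
pose z := \col_i (if odd n && (i == 0) then 2 * y i 0 else y i 0).
have zE : W *m u^T = diag_mx D *m z.
  rewrite Wu; apply/colP => i; rewrite mul_diag_mx !mxE.
  by case: ifP; rewrite ?mul1r.
have uE := gram_solve det_walk_neq0 gram zE.
exists (\adj P *m z)^T; split.
  by rewrite -redM -uE redZ intr_F2_odd // scale1r.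
(* Entry 0 of [P x = det P z] is even by the choice of [z]. In row 0 of [P] only the first entry,
   [n], is odd, so [x 0] must be even. *)
move=> on; have : (2 %| (P *m (\adj P *m z)) 0%R 0%R)%Z.
  by rewrite mulmxA mul_mx_adj mul_scalar_mx !mxE on /= dvdz_mull // dvdz_mulr.
have PE j : P 0 j = (W *m W^T) 0 j.
  by rewrite gram mul_diag_mx !mxE on eqxx mul1r.
set x := \adj P *m z; rewrite [x^T 0 0]mxE [(P *m x) 0 0]mxE big_ord_recl rpredDr; last first.
  apply: rpred_sum => i _; rewrite PE walk_gram //= dvdz_mulr //.
  exact: even_moment_ones_deg.
rewrite PE walk_gram // moment0_ones_ones Gauss_dvdzr //.
by rewrite coprimezE /= coprime2n; lia.
Qed.

Local Notation A' := (red 2 A).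
Local Notation d' := (red 2 d).
Local Notation v' := (red 2 v).

Lemma red_sym p : (red p A)^T = red p A.
Proof. by rewrite -red_tr symA. Qed.

Lemma intr_F2_even (z : int) : (2 %| z)%Z -> z%:~R = 0 :> 'F_2.
Proof. by move=> z2; apply/eqP; rewrite intr_Fp_eq0. Qed.

Lemma krylov_deg_sub k : (krylov A' d' k <= krylov A' d' n./2)%MS.
Proof.
apply/row_subP => i; rewrite row_krylov; apply: krylov_isotropic; first exact: red_sym.
by move=> l; rewrite moment_red intr_F2_even ?even_moment_deg.
Qed.

(** All rows of [W] but the first are vectors [d A^i], which modulo 2 lie in the isotropic Krylov
    space of [d]; [x0] is the coordinate on the first row. *)
Lemma red_walk_coord u y : W *m u^T = 2 *: y ->
  exists x0 : int, (odd n -> (2 %| x0)%Z) /\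
    (red 2 (u - x0 *: v) <= krylov A' d' n./2)%MS.
Proof.
case/red2_walk_coord => x [xE x0]; exists (x 0 0); split=> //.
rewrite redD -scaleNr redZ xE red_walk mul_walk mxE rmorphN scaleNr.
rewrite addrAC subrr add0r; apply: submx_trans (submxMl _ _) _.
exact: krylov_deg_sub.
Qed.

(** Here [x0] is even, so modulo 2 [u] lies in the Krylov space of [d]. The halved Gram matrix of
    the [r] vectors [d A^i] is [P] without row and column 0. Row 0 of [P] is even past its first
    entry, so this minor is odd because [det P] is. *)
Lemma odd_order_eq0 u y : odd n -> W *m u^T = 2 *: y ->
  (forall l, (4 %| moment A l u u)%Z) -> red 2 u = 0.
Proof.
move=> on Wu u4; have [P [gram detP]] := walk_gram_diag.
have [x0 [/(_ on) x0E ux]] := red_walk_coord Wu.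
have [P2 P2E] : exists P2, krylov A d r *m (krylov A d r)^T = 2 *: P2.
  apply: (@red_eq0 2) => //; apply/red2_eq0 => i j.
  by rewrite krylov_gram // even_moment_deg.
have P2P : P2 = row' 0 (col' 0 P).
  apply/matrixP => i j; apply: (@mulfI _ 2) => //.
  transitivity (moment A (i + j) d d).
    by move/matrixP/(_ i j): P2E; rewrite krylov_gram // mxE.
  have := walk_gram v d (lift 0 i) (lift 0 j) symA.
  by rewrite gram mul_diag_mx /= !mxE /= andbF => <-.
have detP2 : ~~ (2 %| \det P2)%Z.
  apply: contra detP; rewrite (expand_det_row _ 0) big_ord_recl P2P => dP2.
  rewrite rpredD //.
    by apply: dvdz_mull; rewrite /cofactor mul1r.
  apply: rpred_sum => j _; apply: dvdz_mulr.
  have := walk_gram v d 0 (lift 0 j) symA.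
  rewrite gram mul_diag_mx !mxE on eqxx mul1r /= => ->.
  exact: even_moment_ones_deg.
apply: (half_krylov_eq0 symA even_moment_deg P2E detP2 u4).
have -> : uphalf r = n./2 by [].
move: ux; rewrite redD -scaleNr redZ rmorphN /=; by rewrite intr_F2_even // oppr0 scale0r addr0.
Qed.

(** For odd [c] the Krylov matrix of the all-ones vector differs from [W] by odd row factors, and
    modulo 2 [d] is [1 A]. As [n] is even, all moments of [1] are even, so [half_krylov_eq0] applies
    to [1] itself. *)
Lemma odd_factor_eq0 u y : ~~ odd n -> ~~ (2 %| c)%Z -> W *m u^T = 2 *: y ->
  (forall l, (4 %| moment A l u u)%Z) -> red 2 u = 0.
Proof.
move=> en oc Wu u4; have [x0 [_ ux]] := red_walk_coord Wu.
have ev k : (2 %| moment A k v v)%Z.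
  case: k => [|k]; first by rewrite moment0_ones_ones; move: en; lia.
  by rewrite momentS_ones dvdz_mull // momentC // even_moment_ones_deg.
have dE : d' = v' *m A'.
  by rewrite -redM vA redZ intr_F2_odd // scale1r.
have span l : (v' *m A' ^+ l <= krylov A' v' n./2)%MS.
  apply: krylov_isotropic; first exact: red_sym.
  by move=> k; rewrite moment_red intr_F2_even.
have [P PE] : exists P, krylov A v n *m (krylov A v n)^T = 2 *: P.
  apply: (@red_eq0 2) => //; apply/red2_eq0 => i j.
  by rewrite krylov_gram.
have detP : ~~ (2 %| \det P)%Z.
  have E : 2 ^+ n * \det P = 2 ^+ n * ((c ^+ r * m) * (c ^+ r * m)).
    rewrite -detZ -PE det_mulmx det_tr (det_krylov_walk vA) detW.
    have -> : 2 ^+ n = 2 ^+ n./2 * 2 ^+ n./2 :> int by rewrite -exprD; congr (_ ^+ _); lia.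
    by ring.
  have /mulfI/(_ _ _ E) -> : 2 ^+ n != 0 :> int by rewrite expf_eq0 andbF.
  by rewrite -(@intr_Fp_eq0 2) // !rmorphM rmorphXn /= !intr_F2_odd // expr1n.
apply: (half_krylov_eq0 symA ev PE detP u4).
have -> : uphalf n = n./2 by lia.
have -> : red 2 u = red 2 (u - x0 *: v) + x0%:~R *: v'.
  by rewrite -redZ -redD subrK.
apply: addmx_sub; last first.
  by apply: scalemx_sub; have := span 0%N; rewrite expr0 mulmx1.
apply: submx_trans ux _; apply/row_subP => i.
by rewrite row_krylov dE; move: (span i.+1); rewrite exprS mulmxA. 
Qed.

(** Coordinates with respect to the rows of [walk]: [b i] belongs to [d A^(2i)], which is row
    [2i + 1]. *)
Let spread (b : nat -> int) : 'rV[int]_n :=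
  \row_j (if (j : nat) is s.+1 then (if odd s then 0 else b s./2) else 0).

Lemma even_gram P (i j : 'I_n) : ~~ odd n -> W *m W^T = diag_mx D *m P ->
  2 * P i j = (W *m W^T) i j.
Proof. by move=> en ->; rewrite mul_diag_mx !mxE (negPf en). Qed.

(** Column [j = l + 2] corresponds to [u A^(l+1) u^T]. The mixed terms with the all-ones vector come
    twice and carry the even factor [c], and [1 A^(l+1) 1^T] is [c] times an even number. Modulo 4
    only the form in the [b i] remains, and it is linear. The positive exponent is what brings out
    [c], whence [1 < j]. *)
Lemma spread_gram u b0 (b : nat -> int) t P (j : 'I_n) :
  ~~ odd n -> (2 %| c)%Z -> W *m W^T = diag_mx D *m P ->
  u = b0 *: v + \sum_(i < n./2) b i *: (d *m A ^+ i) + 2 *: t ->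
  (forall l, (4 %| moment A l u u)%Z) -> (1 < j)%N -> (2 %| (spread b *m P) 0%R j)%Z.
Proof.
move=> en ec gram; set y := \sum_(i < _) _ => uE u4 j1.
case: j j1 => [[|[|l]] jn] //= _; set j := Ordinal jn.
have cE z : (4 %| c * moment A l d z *+ 2)%Z.
  by rewrite -[c * _ *+ 2]mulr_natr mulrAC dvdz_mulr // dvd4_mul.
have vv : moment A l.+1 v v = c * moment A l v d by rewrite momentS_ones momentC.
have y4 : (4 %| moment A l.+1 y y)%Z.
  have : (4 %| moment A l.+1 (b0 *: v + y) (b0 *: v + y))%Z.
    by rewrite -(rpredDl _ (moment_mod4 symA l.+1 (b0 *: v + y) t)) subrK -uE.
  rewrite !(momentDl, momentDr, momentZl, momentZr) [moment A _ y v]momentC //.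
  rewrite vv addrA -[_ + b0 * moment A _ v y]addrA -mulr2n rpredDl //.
  apply: rpredD.
    by do 2 apply: dvdz_mull; apply: dvd4_mul => //; apply: even_moment_ones_deg.
  by rewrite momentS_ones -mulrnAr; apply: dvdz_mull.
rewrite -(@dvdz_mul2l 2 2) //.
have -> : 2 * (spread b *m P) 0 j = \sum_(i < n./2) b i * moment A (i.*2 + l.+1) d d.
  rewrite [in LHS]mxE mulr_sumr big_ord_recl [spread b 0 ord0]mxE /= mul0r mulr0 add0r.
  rewrite (eq_bigr (fun s : 'I_r => if odd s then 0 else b s./2 * moment A (s + l.+1) d d)).
    rewrite (sum_even_ord _ (fun s => b s./2 * moment A (s + l.+1) d d)).
    by apply: eq_bigr => i _; rewrite doubleK.
  move=> s _; rewrite mulrCA (even_gram _ _ en gram) walk_gram //= [spread b 0 _]mxE /=.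
  by case: ifP; rewrite ?mul0r.
rewrite -(rpredDl _ (moment_krylov_mod4 symA l.+1 n./2 b even_moment_deg)) -/y.
by rewrite subrK.
Qed.

(* The n/2 + 1 vectors 1 and d A^i span an isotropic space, of dimension at most n/2. *)
Lemma ones_deg_relation : ~~ odd n ->
  exists (b0 : int) (b : nat -> int) t,
    [/\ 0 = b0 *: v + \sum_(i < n./2) b i *: (d *m A ^+ i) + 2 *: t
      & exists i : 'I_n./2, ~~ (2 %| b i)%Z].
Proof.
move=> en; pose K := krylov A' d' n./2; pose M := col_mx v' K.
have MM : M *m M^T = 0.
  apply/matrixP => i j; rewrite tr_col_mx mul_col_row.
  have -> : v' *m v'^T = 0.
    apply/matrixP => s t; rewrite !ord1 [RHS]mxE.
    have -> : (v' *m v'^T) 0 0 = moment A' 0 v' v' by rewrite /moment expr0 mulmx1.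
    by rewrite moment_red intr_F2_even // moment0_ones_ones; move: en; lia.
  have Kv : K *m v'^T = 0.
    apply/matrixP => s t; rewrite !ord1 [RHS]mxE.
    transitivity (moment A' s d' v').
      by rewrite /moment -row_krylov -row_mul [RHS]mxE.
    by rewrite momentC ?red_sym // moment_red intr_F2_even ?even_moment_ones_deg.
  have -> : K *m K^T = 0.
    apply/matrixP => s t; rewrite krylov_gram ?red_sym // mxE.
    by rewrite moment_red intr_F2_even ?even_moment_deg.
  have -> : v' *m K^T = 0 by apply: trmx_inj; rewrite trmx_mul trmxK Kv trmx0.
  by rewrite Kv block_mx0.
have /rowV0Pn[x /sub_kermxP xM x0] : kermx M != 0.
  by rewrite -mxrank_eq0 mxrank_ker; have := mulmx0_rank_max MM; rewrite mxrank_tr; lia.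
rewrite -(hsubmxK x) mul_row_col in xM.
have [b0 b0E] := intr_Fp_surj (lsubmx x 0 0).
have xl : lsubmx x = b0%:~R%:M by rewrite [LHS]mx11_scalar b0E.
have /red_krylov_lift[//|b [t [bE tE]]] : red 2 (- b0 *: v) = rsubmx x *m K.
  apply/eqP; rewrite redZ rmorphN scaleNr eq_sym -addr_eq0 addrC -mul_scalar_mx -xl.
  by rewrite xM.
exists b0, b, t; split.
  by rewrite -addrA -tE scaleNr subrr.
(* If all [b i] were even, the relation would reduce to [b0] times the all-ones vector, so [b0] and
   then [x] would vanish. *)
apply/existsP; apply: contraNT x0 => /existsPn b_even.
have xr : rsubmx x = 0.
  by apply/rowP => i; rewrite bE mxE intr_F2_even //; apply: negbNE; apply: b_even.
rewrite xr mul0mx addr0 xl mul_scalar_mx in xM; rewrite -[x]hsubmxK xr xl.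
move/eqP: xM; rewrite scaler_eq0 => /orP[/eqP ->|/eqP/rowP/(_ 0)].
  by rewrite raddf0 row_mx0.
by rewrite !mxE => /eqP; rewrite intr_Fp_eq0.
Qed.

(** Multiplied by [P], the first unit vector and the spread coefficients of [u] and of the relation
    from [ones_deg_relation] vanish modulo 2 beyond two columns, so the three are dependent. Hence
    the coefficients of [u] are proportional to those of the relation, whose combination of the
    [d A^i] is a multiple of the all-ones vector. *)
Lemma even_factor_eq0_or_ones u y : ~~ odd n -> (2 %| c)%Z -> W *m u^T = 2 *: y ->
  (forall l, (4 %| moment A l u u)%Z) -> exists mu, red 2 u = mu *: v'.
Proof.
move=> en ec Wu u4; have [P [gram detP]] := walk_gram_diag.
have [b0 [b [s [bE [i0 bi0]]]]] := ones_deg_relation en.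
have [x0 [_ /submxP[g /red_krylov_lift[//|e [t [_ ux]]]]]] := red_walk_coord Wu.
have eE : u = x0 *: v + \sum_(i < n./2) e i *: (d *m A ^+ i) + 2 *: t.
  by rewrite -addrA -ux addrC subrK.
have Y4 := spread_gram en ec gram.
have z4 l : (4 %| moment A l 0%R 0%R)%Z by rewrite -(scale0r (0 : 'rV_n)) momentZl mul0r.
pose w : 'M['F_2]_(3, n) :=
  \matrix_(i < 3) (if i == 0 then delta_mx 0 0
                   else if i == 1 then red 2 (spread e) else red 2 (spread b)).
have uP : red 2 P \in unitmx by rewrite unitmxE det_red unitfE intr_Fp_eq0.
have [|x x_neq0 xw] := dependent_rank2 (w := w) uP.
  move=> i j j1; have -> : (w *m red 2 P) i j = (row i w *m red 2 P) 0 j.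
    by rewrite -row_mul [RHS]mxE.
  rewrite rowK; case: ifP => _; last case: ifP => _.
  - rewrite -rowE mxE mxE intr_F2_even //.
    rewrite -(@dvdz_mul2l 2 2) // even_gram // walk_gram //=.
    case: (j : nat) j1 => [|[|l]] // _.
    by rewrite momentS_ones dvd4_mul // even_moment_deg.
  - by rewrite -redM mxE intr_F2_even //; apply: Y4 eE u4 j1.
  - by rewrite -redM mxE intr_F2_even //; apply: Y4 bE z4 j1.
have rel : x 0 0 *: delta_mx 0 0 + (x 0 1 *: red 2 (spread e) + x 0 2 *: red 2 (spread b)) = 0.
  by rewrite -xw mulmx_sum_row sum_ord3 !rowK.
have rel_coef (i : 'I_n./2) : x 0 1 * (e i)%:~R + x 0 2 * (b i)%:~R = 0.
  have ir : ((i : nat).*2.+1 < n)%N by have := ltn_ord i; move: en; lia.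
  by move/rowP/(_ (Ordinal ir)): rel; rewrite !mxE /= odd_double doubleK mulr0 add0r.
(* Otherwise the odd [b i0] forces [x 0 2 = 0], and the first coordinate then gives [x 0 0 = 0]. *)
have x1 : x 0 1 != 0.
  apply: contraNneq x_neq0 => x1.
  have x2 : x 0 2 = 0.
    have /eqP := rel_coef i0; rewrite x1 mul0r add0r mulf_eq0 => /orP[/eqP //|].
    by rewrite intr_Fp_eq0 // (negPf bi0).
  move/rowP/(_ 0): rel; rewrite x1 x2 !scale0r !addr0 !mxE /= mulr1 => x0E.
  apply/eqP/rowP => i; rewrite mxE; case: i => [[|[|[|]]] i3] //.
  - by rewrite -[RHS]x0E; congr (x 0 _); apply: val_inj.
  - by rewrite -[RHS]x1; congr (x 0 _); apply: val_inj.
  - by rewrite -[RHS]x2; congr (x 0 _); apply: val_inj.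
pose q := - (x 0 2 / x 0 1).
have eb (i : 'I_n./2) : (e i)%:~R = q * (b i)%:~R.
  apply: (mulfI x1); rewrite mulrA mulrN mulrCA divff // mulr1 mulNr.
  by apply/eqP; rewrite -addr_eq0 rel_coef.
have red_comb (f : nat -> int) :
    red 2 (\sum_(i < n./2) f i *: (d *m A ^+ i)) =
    \sum_(i < n./2) (f i)%:~R *: red 2 (d *m A ^+ i).
  rewrite /red raddf_sum; apply: eq_bigr => i _; exact: redZ.
have sum_b : \sum_(i < n./2) (b i)%:~R *: red 2 (d *m A ^+ i) = - b0%:~R *: v'.
  have := congr1 (fun M => red 2 M) bE; rewrite /= !redD redZ redZp // red_comb addr0.
  by rewrite -[0](scale0r 0) redZ scale0r scaleNr => /esym/eqP; rewrite addrC addr_eq0 => /eqP.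
exists (x0%:~R + q * - b0%:~R).
rewrite eE !redD redZ redZp // red_comb addr0 scalerDl; congr (_ + _).
under eq_bigr do rewrite eb -scalerA.
by rewrite -scaler_sumr sum_b scalerA.
Qed.

(** For even [n] every entry of [D] is 2, so [W u^T = D (2 y)] and [gram_solve] makes an odd
    multiple of [u] even. *)
Lemma even_order_div4_eq0 (u : 'rV_n) y : ~~ odd n -> W *m u^T = 4 *: y -> red 2 u = 0.
Proof.
move=> en Wu; have [P [gram detP]] := walk_gram_diag.
have zE : W *m u^T = diag_mx D *m (2 *: y).
  rewrite Wu; apply/colP => i; rewrite mul_diag_mx !mxE (negPf en) /=; ring.
have := congr1 (fun M : 'rV_n => red 2 M) (gram_solve det_walk_neq0 gram zE).
by rewrite /= redZ intr_F2_odd // scale1r -scalemxAr [(2 *: _)^T]linearZ /= -scalemxAl redZp.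
Qed.

Lemma even_divisor_ones u y : W *m u^T = 2 *: y ->
  (forall l, (4 %| moment A l u u)%Z) ->
  red 2 u = 0 \/ ~~ odd n /\ exists mu, red 2 u = mu *: v'.
Proof.
move=> Wu u4; case on: (odd n); first by left; apply: odd_order_eq0 Wu u4.
have [ec|oc] := boolP (2 %| c)%Z.
  by right; split=> //; apply: even_factor_eq0_or_ones Wu u4; rewrite ?on.
by left; apply: odd_factor_eq0 Wu u4; rewrite ?on.
Qed.

Hypothesis order_ge5 : (4 < n)%N.
Hypothesis m_squarefree : squarefree m.
Hypothesis full_rank : forall p, prime p -> odd p -> (p %| c)%Z -> red p W \in unitmx.

(* U is the primitive integral multiple l Q of the rational orthogonal matrix Q
   (transposed) that carries one graph to the other. *)
Lemma level_eq1 (l : nat) (U Y : 'M[int]_n) :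
  (0 < l)%N -> W *m U^T = l%:Z *: Y -> U *m U^T = (l%:Z ^+ 2)%:M ->
  (exists B, U *m A *m U^T = l%:Z ^+ 2 *: B) ->
  (forall k, exists B, U *m A ^+ k *m U^T = l%:Z ^+ 2 *: B) ->
  (forall p, prime p -> (p %| l)%N -> exists i, red p (row i U) != 0) ->
  l = 1%N.
Proof.
move=> l_gt0 WU UU [B1 UB1] UB prim.
have Wrow i : W *m (row i U)^T = l%:Z *: col i Y.
  apply/colP => j; have /matrixP/(_ j i) := WU; rewrite [LHS]mxE [RHS]mxE => E.
  by rewrite [LHS]mxE [RHS]mxE [col i Y j 0]mxE -E; apply: eq_bigr => k _; rewrite !mxE.
have rowE (M : 'M[int]_n) i : row i U *m M *m (row i U)^T = ((U *m M *m U^T) i i)%:M.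
  rewrite [LHS]mx11_scalar -row_mul; congr (_%:M).
  by rewrite [LHS]mxE [RHS]mxE; apply: eq_bigr => k _; rewrite !mxE.
have only2 p : prime p -> (p %| l)%N -> p = 2%N.
  move=> p_pr p_l; case: (even_prime p_pr) => // p_odd.
  have [i /negP[]] := prim p p_pr p_l; apply/eqP.
  have [q lE] : exists q, l%:Z = p%:Z * q%:Z.
    by case/dvdnP: p_l => q ->; exists q; rewrite PoszM mulrC.
  have Wi : red p (W *m (row i U)^T) = 0 by rewrite Wrow lE -scalerA redZp.
  (* If p divides [c], then [W] is invertible modulo p. Otherwise the Krylov determinant
     [c^r 2^(n/2) m] is not divisible by p^2, as [m] is square-free. *)
  have [pc|pc] := boolP (p %| c)%Z.
    apply: trmx_inj; rewrite trmx0 -red_tr -[LHS](mulKmx (full_rank p_pr p_odd pc)).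
    by rewrite -redM Wi mulmx0.
  have sq (M B : 'M[int]_n) : U *m M *m U^T = l%:Z ^+ 2 *: B ->
      row i U *m M *m (row i U)^T = p%:Z ^+ 2 *: (q%:Z ^+ 2 * B i i)%:M.
    by move=> E; rewrite rowE E mxE lE exprMn scale_scalar_mx mulrA.
  have sq0 : row i U *m (row i U)^T = p%:Z ^+ 2 *: (q%:Z ^+ 2 * 1%:M i i)%:M.
    by have := sq 1%:M 1%:M; rewrite !mulmx1; apply; rewrite UU scalemx1.
  apply: (krylov_orthogonal_eq0 p_pr symA (v := v)) sq0 (sq _ _ UB1).
    rewrite (det_krylov_walk vA) detW.
    have cop x : ~~ (p %| x)%Z -> coprimez (p%:Z ^+ 2) x.
      by move=> px; rewrite coprimezXl // coprimezE prime_coprime.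
    rewrite Gauss_dvdzr; last by rewrite coprimezXr // cop.
    rewrite Gauss_dvdzr; last first.
      rewrite coprimezXr // cop // -[(_ %| _)%Z]/(p %| 2)%N dvdn_prime2 //.
      by apply: contraTneq p_odd => ->.
    apply/negP => /m_squarefree p1. by move: p_pr; rewrite (p1 : p = 1%N).
  apply: trmx_inj; rewrite -red_tr trmx_mul trmxK trmx0 (krylov_walk vA) -mulmxA.
  by rewrite redM Wi mulmx0.
apply/eqP; apply: contraT => l_neq1.
have l2 : (2 %| l)%N by rewrite -(only2 (pdiv l)) ?pdiv_dvd // pdiv_prime; lia.
have [l' lE] : exists l', l = (2 * l')%N by case/dvdnP: l2 => l' ->; exists l'; rewrite mulnC.
have [i ui] := prim 2%N isT l2; set u := row i U in ui.
have Wu : W *m u^T = 2 *: (l'%:Z *: col i Y) by rewrite Wrow lE PoszM scalerA.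
have momentE k (B : 'M[int]_n) : U *m A ^+ k *m U^T = l%:Z ^+ 2 *: B ->
    moment A k u u = 4 * (l'%:Z ^+ 2 * B i i).
  by move=> E; rewrite /moment rowE E !mxE eqxx mulr1n lE PoszM; ring.
have u4 k : (4 %| moment A k u u)%Z.
  by have [B /momentE ->] := UB k; rewrite dvdz_mulr.
have uu : moment A 0 u u = l%:Z ^+ 2.
  rewrite (momentE 0%N 1%:M) ?expr0 ?mulmx1 ?UU ?scalemx1 // mxE eqxx mulr1n lE PoszM; ring.
case: (even_divisor_ones Wu u4) => [u0|[en [mu uE]]]; first by rewrite u0 eqxx in ui.
(* An even [l'] would make [l] divisible by 4 and [u] zero modulo 2. *)
have l'_odd : ~~ (2 %| l')%N.
  apply: contra ui => /dvdnP[q qE]; apply/eqP.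
  apply: (@even_order_div4_eq0 _ (q%:Z *: col i Y) en).
  by rewrite Wu qE !scalerA PoszM; congr (_ *: _); ring.
have l'1 : l' = 1%N.
  apply/eqP; apply: contraNT l'_odd => l'_neq1.
  have l'0 : (0 < l')%N by lia.
  rewrite -(only2 (pdiv l')) ?pdiv_dvd ?pdiv_prime //; first by lia.
  by rewrite lE dvdn_mull ?pdiv_dvd.
have mu0 : mu != 0 by apply: contraNneq ui => mu0; rewrite uE mu0 scale0r.
have u_odd j : 1 <= u 0 j * u 0 j.
  have : u 0 j != 0.
    apply: contraNneq mu0 => uj; have /rowP/(_ j) := uE.
    by rewrite [LHS]mxE uj [RHS]mxE [v' 0 j]mxE [const_mx 1 0 j]mxE rmorph1 mulr1 => <-.
  by lia.
(* No entry of [u] vanishes, so [u u^T] is at least [n > 4], while it equals [l^2 = 4]. *)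
have : \sum_(j < n) 1 <= \sum_(j < n) u 0 j * u 0 j by apply: ler_sum.
rewrite -(momentE0 A) uu sumr_const card_ord lE l'1 natz; lia.
Qed.

End ModTwo.

(** * Walk counts from characteristic polynomials *)

Lemma mulmx_detI (R : idomainType) n k (M : 'M[R]_n) :
  \det M != 0 -> injective (fun N : 'M_(n, k) => M *m N).
Proof.
move=> M0 N N' E; have := congr1 (fun N : 'M_(n, k) => \adj M *m N) E.
rewrite /= !mulmxA mul_adj_mx !mul_scalar_mx => /matrixP E'.
by apply/matrixP => i j; apply: (mulfI M0); have := E' i j; rewrite !mxE.
Qed.

Lemma congr_detI (R : idomainType) n (M X Y : 'M[R]_n) :
  \det M != 0 -> M *m X *m M^T = M *m Y *m M^T -> X = Y.
Proof.
move=> M0; rewrite -!mulmxA => /(mulmx_detI M0) E; apply: trmx_inj.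
by apply: (mulmx_detI M0); rewrite /= -[M]trmxK -!trmx_mul E.
Qed.

(** The bordered matrix [N] has determinant [det (M - u w)] by clearing its last row; clearing that
    row with [adj M] instead gives [det M] times the right-hand side. *)
Lemma det_rank1_update (R : idomainType) n (M : 'M[R]_n) (u : 'cV_n) (w : 'rV_n) :
  \det M != 0 -> \det (M - u *m w) = \det M - (w *m \adj M *m u) 0 0.
Proof.
move=> M0; pose N := block_mx M u w (1%:M : 'M_1).
have detN : \det N = \det (M - u *m w).
  have : N *m block_mx 1%:M 0 (- w) 1%:M = block_mx (M - u *m w) u 0 1%:M.
    by rewrite mulmx_block !mulmx1 !mulmx0 !add0r mulmxN mul1mx subrr.
  move/(congr1 determinant); rewrite det_mulmx det_lblock det_ublock !det1 !mulr1.
  exact.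
have : block_mx 1%:M 0 (- (w *m \adj M)) (\det M)%:M *m N =
    block_mx M u 0 ((\det M)%:M - w *m \adj M *m u).
  rewrite mulmx_block !mul1mx !mul0mx !addr0 !mulNmx -mulmxA mul_adj_mx.
  by rewrite mul_mx_scalar mul_scalar_mx addNr mul_scalar_mx scalemx1 addrC.
move/(congr1 determinant); rewrite det_mulmx det_lblock det_ublock det1 mul1r det_scalar1.
rewrite detN => /(mulfI M0) ->.
by rewrite [X in \det X]mx11_scalar det_scalar1 !mxE mulr1n.
Qed.

Lemma size_det_linear (R : idomainType) n (M : 'M[{poly R}]_n) :
  (forall i j, (size (M i j) <= 2)%N) -> (size (\det M) <= n.+1)%N.
Proof.
move=> M2.
have sz (f : 'I_n -> 'I_n) : (size (\prod_i M i (f i))%R <= n.+1)%N.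
  apply: leq_trans (size_poly_prod_leq _ _) _.
  rewrite leq_subLR addnS ltnS (eq_card (B := 'I_n)) // card_ord addnn -muln2.
  have <- : (\sum_(i < n) 2 = n * 2)%N by rewrite sum_nat_const card_ord.
  by apply: leq_sum => i _; apply: M2.
rewrite /determinant; apply: leq_trans (size_sum _ _ _) _.
apply/bigmax_leqP => s _; rewrite mulr_sign.
by case: ifP => _; rewrite ?size_polyN; apply: sz.
Qed.

Section WalkGenerating.
Variables (F : fieldType) (r : nat) (v : 'rV[F]_r.+1).
Local Notation n := r.+1.
Local Notation pc := (map_mx polyC).

(** The numerator over [char_poly A] of the generating function of the moments of order at least
    [k], in powers of 1/X. *)
Definition walk_gen (A : 'M[F]_n) k : {poly F} :=
  (pc (v *m A ^+ k) *m \adj (char_poly_mx A) *m pc v^T) 0 0.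

Lemma char_poly_rank1 (A : 'M[F]_n) t :
  char_poly (A + t *: (v^T *m v)) = char_poly A - t *: walk_gen A 0.
Proof.
rewrite /char_poly; have -> : char_poly_mx (A + t *: (v^T *m v)) =
    char_poly_mx A - (t%:P *: pc v^T) *m pc v.
  rewrite /char_poly_mx map_mxD opprD addrA; congr (_ - _).
  by rewrite map_mxZ map_mxM -scalemxAl.
rewrite det_rank1_update; last by rewrite -/(char_poly A) monic_neq0 ?char_poly_monic.
by rewrite /walk_gen expr0 mulmx1 -scalemxAr mxE mul_polyC.
Qed.

Lemma size_walk_gen A k : (size (walk_gen A k) <= n)%N.
Proof.
have cA i j : (size ((\adj (char_poly_mx A)) i j) <= n)%N.
  rewrite mxE /cofactor -signr_odd mulr_sign; set M := row' _ _.
  have : (size (\det M) <= n)%N.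
    apply: size_det_linear => s t; rewrite !mxE; case: eqP => _.
      by rewrite mulr1n size_XsubC.
    by rewrite mulr0n sub0r size_polyN (leq_trans (size_polyC_leq1 _)).
  by case: ifP => _; rewrite ?size_polyN.
rewrite /walk_gen mxE; apply: leq_trans (size_sum _ _ _) _; apply/bigmax_leqP => j _.
rewrite mulrC [pc v^T j 0]mxE mul_polyC; apply: leq_trans (size_scale_leq _ _) _.
rewrite mxE; apply: leq_trans (size_sum _ _ _) _; apply/bigmax_leqP => i _.
by rewrite mxE mul_polyC; apply: leq_trans (size_scale_leq _ _) (cA _ _).
Qed.

Lemma walk_genS A k :
  'X * walk_gen A k = walk_gen A k.+1 + moment A k v v *: char_poly A.
Proof.
have E : 'X *: \adj (char_poly_mx A) = pc A *m \adj (char_poly_mx A) + (char_poly A)%:M.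
  by rewrite -mul_mx_adj {2}/char_poly_mx mulmxBl mul_scalar_mx addrC subrK.
transitivity (('X *: (pc (v *m A ^+ k) *m \adj (char_poly_mx A) *m pc v^T)) 0 0).
  by rewrite [RHS]mxE.
rewrite scalemxAl scalemxAr E mulmxDr mulmxDl mxE; congr (_ + _).
  by rewrite /walk_gen mulmx_exprS [in RHS]map_mxM !mulmxA.
by rewrite mul_mx_scalar -scalemxAl -map_mxM mxE [X in _ * X]mxE mulrC mul_polyC.
Qed.

(** The rank-one updates determine [walk_gen _ 0]. By [walk_genS], dividing ['X * walk_gen A k] by
    [char_poly A] has the moment as quotient and the next numerator as remainder, of degree below
    [n]; uniqueness of division propagates the equality. *)
Lemma moment_char_poly (A B : 'M[F]_n) t : t != 0 ->
  char_poly A = char_poly B ->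
  char_poly (A + t *: (v^T *m v)) = char_poly (B + t *: (v^T *m v)) ->
  forall k, moment A k v v = moment B k v v.
Proof.
move=> t0 pAB; rewrite !char_poly_rank1 -pAB => /addrI/oppr_inj/(scalerI t0) q0.
have step k : walk_gen A k = walk_gen B k ->
    moment A k v v = moment B k v v /\ walk_gen A k.+1 = walk_gen B k.+1.
  move=> qk; have := walk_genS A k; rewrite qk walk_genS -pAB => E.
  have mE : moment A k v v = moment B k v v.
    apply/eqP; rewrite -subr_eq0; apply: contraTT (leqnn n) => s0; rewrite -ltnNge.
    rewrite -(size_char_poly A) -(size_scale _ s0) scalerBl.
    have -> : moment A k v v *: char_poly A - moment B k v v *: char_poly A =
        walk_gen B k.+1 - walk_gen A k.+1.
      by apply/eqP; rewrite subr_eq addrAC eq_sym subr_eq E addrC.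
    apply: leq_trans (size_polyD _ _) _; rewrite size_polyN geq_max.
    by apply/andP; split; apply: size_walk_gen.
  by split; [exact: mE | move: E; rewrite mE => /addIr/esym E; exact: E].
have q k : walk_gen A k = walk_gen B k by elim: k => [|k /step[_ E]]; [exact: q0 | exact: E].
by move=> k; have [] := step k (q k).
Qed.

End WalkGenerating.

(** * From walk counts to a permutation *)

Lemma mulmx_moment (R : comNzRingType) n p q (A : 'M[R]_n) k (M : 'M_(p, n)) (N : 'M_(q, n)) i j :
  (M *m A ^+ k *m N^T) i j = moment A k (row i M) (row j N).
Proof.
rewrite /moment -row_mul [LHS]mxE [RHS]mxE.
by apply: eq_bigr => s _; rewrite !mxE.
Qed.

Lemma det_gram_neq0 (R : idomainType) n (W V : 'M[R]_n) :
  W *m W^T = V *m V^T -> \det W != 0 -> \det V != 0.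
Proof.
move=> /(congr1 determinant); rewrite !det_mulmx !det_tr => E W0.
by have := mulf_neq0 W0 W0; rewrite E mulf_eq0 orbb.
Qed.

(** Multiplying both sides by the diagonal matrix [D] turns the walk matrices into Krylov matrices
    of [v], whose products have moments of [v] as entries; [D] is then cancelled. *)
Lemma walk_moment_eq r (A B : 'M[int]_r.+1) (v d e : 'rV_r.+1) (c : int) k :
  A^T = A -> B^T = B -> c != 0 -> v *m A = c *: d -> v *m B = c *: e ->
  (forall l, moment A l v v = moment B l v v) ->
  walk A v d r.+1 *m A ^+ k *m (walk A v d r.+1)^T =
  walk B v e r.+1 *m B ^+ k *m (walk B v e r.+1)^T.
Proof.
move=> symA symB c0 vA vB mAB; set D : 'M_r.+1 := diag_mx (\row_i (if i == 0 then 1 else c)).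
have D0 : \det D != 0.
  rewrite det_diag prodf_seq_neq0; apply/allP => i _ /=; rewrite mxE.
  by case: ifP => _; rewrite ?oner_eq0.
have DW (M : 'M_r.+1) f (vM : v *m M = c *: f) :
    D *m (walk M v f r.+1 *m M ^+ k *m (walk M v f r.+1)^T) *m D^T =
    krylov M v r.+1 *m M ^+ k *m (krylov M v r.+1)^T.
  by rewrite (krylov_walk vM) trmx_mul !mulmxA.
have KE (M : 'M_r.+1) (symM : M^T = M) i j :
    (krylov M v r.+1 *m M ^+ k *m (krylov M v r.+1)^T) i j = moment M (j + (i + k)) v v.
  by rewrite mulmx_moment !row_krylov moment_expl moment_expr.
apply: (congr_detI D0); apply: etrans (DW A d vA) (etrans _ (esym (DW B e vB))).
by apply/matrixP => i j; exact: etrans (KE A symA i j) (etrans (mAB _) (esym (KE B symB i j))).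
Qed.

(** Each integer [u_i^2 - u_i] is nonnegative and they sum to 0, so every entry is 0 or 1; the sum 1
    leaves a single 1. *)
Lemma int_unit_row n (u : 'rV[int]_n) :
  \sum_i u 0 i * u 0 i = 1 -> \sum_i u 0 i = 1 -> exists j, u = delta_mx 0 j.
Proof.
move=> u2 u1; have d0 i : 0 <= u 0 i * u 0 i - u 0 i by have [->|] := eqVneq (u 0 i) 0; nia.
have : \sum_i (u 0 i * u 0 i - u 0 i) = 0 by rewrite sumrB u2 u1 subrr.
move/(psumr_eq0P (fun i _ => d0 i)) => ui.
have u01 i : u 0 i = 0 \/ u 0 i = 1 by have := ui i isT; nia.
have [j uj] : exists j, u 0 j != 0.
  apply/existsP; apply: contraTT isT => /existsPn u0; move: u1.
  by rewrite big1 // => i _; apply/eqP/negPn; apply: u0.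
have uj1 : u 0 j = 1 by case: (u01 j) => // u0; rewrite u0 eqxx in uj.
exists j; move: u1; rewrite (bigD1 j) //= uj1 => /(canRL (addKr _)); rewrite addNr.
have u_ge0 i : 0 <= u 0 i by case: (u01 i) => ->.
move/(psumr_eq0P (fun i _ => u_ge0 i)) => u0.
apply/rowP => i; rewrite mxE eqxx /=; case: eqVneq => [->|ij] //.
by rewrite u0.
Qed.

Section Level.
Variables (n : nat) (A B W V : 'M[int]_n).

(** For invertible [W] this says that [U] is [l] times the transpose of [Q = W^-1 V]; the case
    [k = 0] is the orthogonality of [Q], and the others its conjugation of [A] to [B]. *)
Definition level (l : nat) (U : 'M[int]_n) : Prop :=
  W *m U^T = l%:Z *: V /\ forall k, U *m A ^+ k *m U^T = l%:Z ^+ 2 *: B ^+ k.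

(** Descent on [l]: a prime dividing both [l] and all rows of [U] is divided out of both. *)
Lemma level_primitive l U : (0 < l)%N -> level l U ->
  exists l' U', [/\ (0 < l')%N, level l' U' &
    forall p, prime p -> (p %| l')%N -> exists i, red p (row i U') != 0].
Proof.
elim/ltn_ind: l U => l IH U l0 lU.
have [/hasP[p]|/hasPn Np] := boolP (has (fun p => [forall i, red p (row i U) == 0]) (primes l)).
  rewrite mem_primes => /and3P[p_pr _ /dvdnP[q lE]] /forallP Up.
  have p0 : p%:Z != 0 by rewrite -lt0n prime_gt0.
  have [U1 UE] : exists U1, U = p%:Z *: U1.
    apply: (red_eq0 p_pr); apply/row_matrixP => i; rewrite row0 -(eqP (Up i)).
    by apply/rowP => j; rewrite !mxE.
  have lZ : l%:Z = p%:Z * q%:Z by rewrite lE PoszM mulrC.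
  case: lU => WU UB; apply: (IH q _ U1).
  - by rewrite lE ltn_Pmulr ?prime_gt1 //; move: l0; rewrite lE; lia.
  - by move: l0; rewrite lE; lia.
  split=> [|k].
    apply: (scalemx_intK p0); rewrite /= scalerA -lZ -WU UE linearZ /= -scalemxAr //.
  apply: (scalemx_intK (mulf_neq0 p0 p0)); rewrite /= [in RHS]scalerA.
  have -> : p%:Z * p%:Z * q%:Z ^+ 2 = l%:Z ^+ 2 by rewrite lZ; ring.
  by rewrite -UB UE linearZ /= -!scalemxAl -scalemxAr scalerA.
exists l, U; split=> // p p_pr pl; have := Np p; rewrite mem_primes p_pr l0 pl => /(_ isT).
by move/forallPn.
Qed.

(** The multiple [(det W)^2] of [W^-1 V] is integral; taking the square rather than [det W] keeps
    the factor positive. *)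
Lemma level_exists : \det W != 0 -> \det V != 0 ->
  (forall k, W *m A ^+ k *m W^T = V *m B ^+ k *m V^T) ->
  exists l U, (0 < l)%N /\ level l U.
Proof.
move=> W0 V0 WV; pose t := \det W; pose Z := t *: (\adj W *m V).
have WZ : W *m Z = t ^+ 2 *: V.
  by rewrite /Z -scalemxAr mulmxA mul_mx_adj mul_scalar_mx scalerA expr2.
have ZZ : Z *m Z^T = (t ^+ 4)%:M.
  apply: (congr_detI W0).
  rewrite -mulmxA -[_ *m _ *m W^T]mulmxA -trmx_mul mulmxA WZ.
  rewrite linearZ /= -scalemxAl -scalemxAr scalerA mul_mx_scalar -scalemxAl -exprD.
  by have := WV 0%N; rewrite !expr0 !mulmx1 => ->.
have t0 : t ^+ 4 != 0 by rewrite expf_neq0.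
have VZ : V *m Z^T = t ^+ 2 *: W.
  apply: (scalemx_intK (expf_neq0 2 W0)); rewrite /= -/t scalemxAl -WZ -mulmxA ZZ.
  by rewrite mul_mx_scalar scalerA -exprD.
exists (`|t| ^ 2)%N, Z^T; split; first by rewrite expn_gt0 absz_gt0 W0.
have lE : (`|t| ^ 2)%N%:Z = t ^+ 2 by rewrite -mulnn PoszM !abszE -expr2 real_normK ?num_real.
split=> [|k]; rewrite lE ?trmxK //.
apply: (congr_detI V0).
have ZV : Z *m V^T = t ^+ 2 *: W^T by rewrite -[Z]trmxK -trmx_mul VZ linearZ.
rewrite !mulmxA VZ -[_ *m Z *m V^T]mulmxA ZV -!scalemxAl -scalemxAr scalerA WV.
by rewrite -scalemxAr -scalemxAl; congr (_ *: _); ring.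
Qed.

End Level.

Lemma moments_permutation r (A B : 'M[int]_r.+1) (d e : 'rV_r.+1) (c a m : int) :
  let v := const_mx 1 in
  A^T = A -> v *m A = c *: d -> (forall i, A i i = a * d 0 i) ->
  (2 %| moment A 0 v d)%Z ->
  \det (walk A v d r.+1) = 2 ^+ r.+1./2 * m -> ~~ (2 %| m)%Z -> (4 < r.+1)%N ->
  squarefree m ->
  (forall p, prime p -> odd p -> (p %| c)%Z -> red p (walk A v d r.+1) \in unitmx) ->
  c != 0 -> B^T = B -> v *m B = c *: e ->
  (forall l, moment A l v v = moment B l v v) ->
  exists2 f : 'I_r.+1 -> 'I_r.+1, bijective f & forall i j, B i j = A (f i) (f j).
Proof.
move=> v symA vA diagA ev detW m_odd n5 sqf full c0 symB vB mAB.
set W := walk A v d r.+1 in detW full; pose V := walk B v e r.+1.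
have W0 : \det W != 0 by apply: det_walk_neq0 detW m_odd.
have WV k := walk_moment_eq k symA symB c0 vA vB mAB; rewrite -/W -/V in WV.
have V0 : \det V != 0.
  by apply: det_gram_neq0 W0; have := WV 0%N; rewrite !expr0 !mulmx1.
have [l0 [U0 [l0_gt0 lU0]]] := level_exists W0 V0 WV.
have [l [U [l_gt0 [WU UB] prim]]] := level_primitive l0_gt0 lU0.
have l1 : l = 1%N.
  apply: (level_eq1 symA vA diagA ev detW m_odd n5 sqf full l_gt0 WU _ _ _ prim).
  - by have := UB 0%N; rewrite !expr0 mulmx1 scalemx1.
  - by exists (B ^+ 1); rewrite -UB expr1.
  - by move=> k; exists (B ^+ k).
rewrite l1 in WU UB.
have UU : U *m U^T = 1%:M by have := UB 0%N; rewrite !expr0 mulmx1 expr1n scale1r.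
(* Both walk matrices start with the all-ones row. *)
have vU : v *m U^T = v.
  have := congr1 (row 0) WU; rewrite row_mul rowK scale1r rowK; exact.
have /fin_all_exists[f fU] i : exists j, row i U = delta_mx 0 j.
  apply: int_unit_row.
    have /matrixP/(_ i i) := UU; rewrite [LHS]mxE [RHS]mxE eqxx mulr1n => <-.
    by apply: eq_bigr => j _; rewrite !mxE.
  have /rowP/(_ i) := vU; rewrite [LHS]mxE [RHS]mxE => <-.
  by apply: eq_bigr => j _; rewrite !mxE mul1r.
have UE i j : U i j = (f i == j)%:R.
  by have /rowP/(_ j) := fU i; rewrite !mxE eqxx eq_sym.
have f_inj : injective f.
  move=> i j fij; apply/eqP; have /matrixP/(_ i j) := UU; rewrite [LHS]mxE [RHS]mxE.
  rewrite (bigD1 (f i)) //= !mxE !UE fij eqxx mulr1 big1 => [|k kf].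
    by case: eqP.
  by rewrite UE fij eq_sym (negPf kf) mul0r.
exists f; first exact: injF_bij.
move=> i j; have := UB 1%N; rewrite !expr1 expr1n scale1r => <-.
rewrite (_ : (U *m A *m U^T) i j = (row i U *m A *m (row j U)^T) 0 0); last first.
  by rewrite -row_mul [LHS]mxE [RHS]mxE; apply: eq_bigr => k _; rewrite !mxE.
by rewrite !fU trmx_delta -rowE -colE !mxE.
Qed.

(** * Graph spectra *)

Lemma momentZ_mx (R : comNzRingType) r (A : 'M[R]_r.+1) c l x y :
  moment (c *: A) l x y = c ^+ l * moment A l x y.
Proof. by rewrite /moment exprZn -scalemxAr -scalemxAl mxE. Qed.

(** [X - (s - M)] is the negative of [(s - X) - M], that is, of the characteristic matrix of [M] at
    [s - X]. *)
Lemma char_poly_shift_opp (F : fieldType) n (M : 'M[F]_n) s :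
  char_poly (s%:M - M) = (-1) ^+ n * (char_poly M \Po (s%:P - 'X)).
Proof.
have -> : char_poly M \Po (s%:P - 'X) = \det (map_mx (comp_poly (s%:P - 'X)) (char_poly_mx M)).
  by rewrite det_map_mx.
rewrite -detZ; congr (\det _); apply/matrixP => i j; rewrite !mxE.
case: eqVneq => _; rewrite ?mulr1n ?mulr0n /=;
  rewrite comp_polyB comp_polyC ?comp_polyX ?comp_poly0 polyCB; ring.
Qed.

Lemma char_poly_shift_opp_inj (F : fieldType) n (M N : 'M[F]_n) s :
  char_poly (s%:M - M) = char_poly (s%:M - N) -> char_poly M = char_poly N.
Proof.
rewrite !char_poly_shift_opp; set q := s%:P - 'X.
have qq : q \Po q = 'X by rewrite comp_polyB comp_polyC comp_polyX opprB addrC subrK.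
have sgn_neq0 : (-1) ^+ n != 0 :> {poly F} by rewrite signr_eq0.
move=> /(mulfI sgn_neq0)/(congr1 (comp_poly q)) /=.
by rewrite -!comp_polyA qq !comp_polyXr.
Qed.

Lemma Spec_char_poly n m (alpha : rat) (G : graph n) (H : graph m) :
  Spec alpha G = Spec alpha H -> char_poly (A_alpha alpha G) = char_poly (A_alpha alpha H).
Proof.
move=> spGH; apply: (map_poly_inj (ratr : {rmorphism rat -> algC})).
by rewrite !map_char_poly !spectrumP -/(Spec alpha G) spGH.
Qed.

Lemma Spec_order n m (alpha : rat) (G : graph n) (H : graph m) :
  Spec alpha G = Spec alpha H -> n = m.
Proof.
by move/Spec_char_poly/(congr1 (fun p : {poly rat} => size p)); rewrite !size_char_poly => -[].
Qed.

Lemma deg_sum n (G : graph n) i : deg G i = (\sum_j G i j)%N.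
Proof.
by rewrite /deg -sum1dep_card big_mkcond; apply: eq_bigr => j _; case: (G i j).
Qed.

Lemma deg_compl n (G : graph n) i : (deg (compl G) i + deg G i).+1 = n.
Proof.
rewrite !deg_sum -big_split /= -[RHS]card_ord -sum1_card [RHS](bigD1 i) //= add1n.
congr _.+1; rewrite (bigD1 i) //= /compl_adj eqxx adj_irr add0n.
by apply: eq_bigr => j ji; rewrite eq_sym ji; case: (G i j).
Qed.

(** The complement has degree matrix [(n - 1) I - D] and adjacency matrix [J - I - A]. Up to sign
    and shift its matrix is thus the rank-one update required by [moment_char_poly]. *)
Lemma A_alpha_compl n alpha (G : graph n) :
  let v : 'rV_n := const_mx 1 in
  A_alpha alpha (compl G) =
  (n%:R * alpha - 1)%:M - (A_alpha alpha G + (alpha - 1) *: (v^T *m v)).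
Proof.
move=> v; apply/matrixP => i j; rewrite !mxE /= big_ord1 !mxE mulr1.
have [<-|ij] := eqVneq i j; last first.
  by rewrite !mulr0n /compl_adj ij /=; case: (G i j) => /=; ring.
rewrite /compl_adj eqxx /= adj_irr !mulr1n.
have -> : n%:R = (deg (compl G) i)%:R + (deg G i)%:R + 1 :> rat.
  by rewrite -natrD natr1 deg_compl.
rewrite mulr0n; ring.
Qed.

Lemma moment_A_alpha_eq r (alpha : rat) (G H : graph r.+1) l :
  let v : 'rV_r.+1 := const_mx 1 in alpha < 1 -> same_gen_spec alpha G H ->
  moment (A_alpha alpha G) l v v = moment (A_alpha alpha H) l v v.
Proof.
move=> v a1 [sp spc]; apply: (@moment_char_poly _ _ _ _ _ (alpha - 1)).
- by rewrite subr_eq0 lt_eqF.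
- exact: Spec_char_poly.
- by have := Spec_char_poly spc; rewrite !A_alpha_compl => /char_poly_shift_opp_inj.
Qed.

(** * The integral matrix of a graph *)

Section IntegralMatrix.
Variables (n : nat) (a b : int).
Implicit Type G : graph n.

(** [a] and [b] stand for the integers [c_alpha * alpha] and [c_alpha * (1 - alpha)]. *)
Definition int_A_c G : 'M[int]_n :=
  \matrix_(i, j) (a * (deg G i)%:Z *+ (i == j) + b * (G i j)%:Z).

Definition int_deg G : 'rV[int]_n := \row_i (deg G i)%:Z.

Lemma int_A_c_sym G : (int_A_c G)^T = int_A_c G.
Proof.
apply/matrixP => i j; rewrite !mxE adj_sym eq_sym.
by case: eqVneq => [->|].
Qed.

Lemma int_deg_sum G i : (deg G i)%:Z = \sum_j (G i j)%:Z.
Proof. by rewrite deg_sum -!natz natr_sum; apply: eq_bigr => j _; rewrite natz. Qed.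

Lemma mul1_int_A_c G : const_mx 1 *m int_A_c G = (a + b) *: int_deg G.
Proof.
apply/rowP => j; rewrite !mxE (eq_bigr (fun i => a * (deg G i)%:Z *+ (i == j) + b * (G j i)%:Z)).
  rewrite big_split /= -mulr_sumr -int_deg_sum (bigD1 j) //= eqxx big1 => [|i /negPf ->].
    by rewrite mulr1n; ring.
  by rewrite mulr0n.
by move=> i _; rewrite !mxE mul1r adj_sym.
Qed.

Lemma int_A_c_diag G i : int_A_c G i i = a * int_deg G 0 i.
Proof. by rewrite !mxE eqxx adj_irr mulr1n mulr0 addr0. Qed.

(** The moment is the sum of all degrees, a sum over a symmetric matrix with zero diagonal. *)
Lemma handshake G : (2 %| moment (int_A_c G) 0 (const_mx 1) (int_deg G))%Z.
Proof.
rewrite momentE0 (eq_bigr (fun i => \sum_j (G i j)%:Z)) => [|i _]; last first.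
  by rewrite !mxE mul1r int_deg_sum.
rewrite sum_symmetric => [|i j]; last by rewrite adj_sym.
rewrite big1 ?add0r => [|i _]; last by rewrite adj_irr.
by rewrite -[X in X \in _]mulr_natr dvdz_mull.
Qed.

End IntegralMatrix.

Lemma map_int_A_c n (alpha : rat) (a b : int) (G : graph n) :
  (c_alpha alpha)%:R * alpha = a%:~R -> (c_alpha alpha)%:R * (1 - alpha) = b%:~R ->
  map_mx intr (int_A_c a b G) = A_c alpha G.
Proof.
move=> ha hb; apply/matrixP => i j; rewrite !mxE mulrDr !mulrA ha hb rmorphD !rmorphM /=.
congr (_ + _ * _); case: eqP => _; rewrite ?mulr1n ?mulr0n ?mulr0 ?rmorph0 //.
by rewrite rmorphM.
Qed.

(** As [A_c] maps the all-ones vector to [c_alpha] times the degree vector, the division by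
    [c_alpha] cancels. The transpose appears because [walk] stores its vectors as rows. *)
Lemma walk_Wtilde r (alpha : rat) (a b : int) (G : graph r.+1) :
  (c_alpha alpha)%:R * alpha = a%:~R -> (c_alpha alpha)%:R * (1 - alpha) = b%:~R ->
  map_mx intr (walk (int_A_c a b G) (const_mx 1) (int_deg G) r.+1) = (Wtilde alpha G)^T.
Proof.
move=> ha hb; have c0 : (c_alpha alpha)%:R != 0 :> rat.
  by have /and3P[c0 _ _] := c_alphaP alpha; rewrite pnatr_eq0 -lt0n.
have symA : (A_c alpha G)^T = A_c alpha G.
  by rewrite -(map_int_A_c G ha hb) map_trmx int_A_c_sym.
apply/matrixP => i j; rewrite [RHS]mxE [RHS]mxE [LHS]mxE [walk _ _ _ _ _ _]mxE.
case: (i : nat) => [|k] /=; first by rewrite mxE.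
rewrite exprSr -mulmxA A_c_mul1 -scalemxAr [in RHS]mxE mulrAC divff // mul1r.
transitivity ((map_mx intr (int_deg G) *m A_c alpha G ^+ k)^T j 0).
  by rewrite -(map_int_A_c G ha hb) -map_mx_expr -map_mxM [RHS]mxE [RHS]mxE.
rewrite trmx_mul trmx_expr //; congr ((_ *m _) _ _).
by apply/matrixP => s t; rewrite !mxE.
Qed.

Theorem theorem1p1 (n : nat) (G : graph n) (alpha : rat)
    (hn : (5 <= n)%N) (hG : connected G) (halpha : 0 <= alpha < 1)
    (hparity : ~ [/\ ~~ odd n, odd (c_alpha alpha) & (3 <= c_alpha alpha)%N])
    (hdet : odd_squarefree_integer (\det (Wtilde alpha G) / 2 ^+ (n./2)))
    (hrank : forall p : nat, prime p -> odd p -> (p %| c_alpha alpha)%N ->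
       \rank (Wtilde_mod alpha G p) = n) :
  DGAS alpha G.
Proof.
move=> m H spGH; have nm : n = m by case: spGH => /Spec_order.
case: m / nm H spGH => H spGH.
case: n => [|r] // in G hn hG hparity hdet hrank H spGH *.
have /and3P[c_gt0 /intrP[a ha] /intrP[b hb]] := c_alphaP alpha.
set c := c_alpha alpha in hrank c_gt0 ha hb.
have /andP[_ alpha1] := halpha.
have c0 : c%:R != 0 :> rat by rewrite pnatr_eq0 -lt0n.
have abE : a + b = c%:Z.
  apply/eqP; rewrite -(eqr_int rat) rmorphD /= -ha -hb -mulrDr addrC subrK mulr1.
  by rewrite pmulrn.
have b0 : b != 0.
  by rewrite -(intr_eq0 rat) -hb mulf_neq0 // subr_eq0 gt_eqF.
have WG := walk_Wtilde G ha hb.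
have [z [zE z_odd z_sqf]] := hdet.
have detW : \det (walk (int_A_c a b G) (const_mx 1) (int_deg G) r.+1) = 2 ^+ r.+1./2 * z.
  apply/eqP; rewrite -(eqr_int rat) -det_map_mx WG det_tr rmorphM rmorphXn /=.
  by rewrite mulrC -zE divfK // expf_neq0.
have moments l : moment (int_A_c a b G) l (const_mx 1) (const_mx 1) =
    moment (int_A_c a b H) l (const_mx 1) (const_mx 1).
  apply/eqP; rewrite -(eqr_int rat) -!moment_map !(map_int_A_c _ ha hb) map_const_mx /A_c.
  by rewrite !momentZ_mx (moment_A_alpha_eq l alpha1 spGH).
have full p : prime p -> odd p -> (p %| c%:Z)%Z ->
    red p (walk (int_A_c a b G) (const_mx 1) (int_deg G) r.+1) \in unitmx.
  move=> p_pr p_odd pc; rewrite -row_free_unit -row_leq_rank.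
  rewrite -mxrank_tr; apply: eq_leq (etrans (esym (hrank p p_pr p_odd pc)) _).
  congr (\rank _); apply/matrixP => i j.
  rewrite [LHS]mxE [RHS]mxE [RHS]mxE.
  by have /matrixP/(_ j i) := WG; rewrite [LHS]mxE [RHS]mxE => <-; rewrite numq_int.
have := moments_permutation (d := int_deg G) (e := int_deg H) (c := c%:Z) (a := a).
case/(_ (int_A_c a b G) (int_A_c a b H) z); rewrite -?abE ?int_A_c_sym ?mul1_int_A_c //.
- exact: int_A_c_diag.
- exact: handshake.
- by rewrite abE.
- by rewrite abE eqz_nat -lt0n.
move=> f f_bij fE; exists f => // x y; have [->|xy] := eqVneq x y; first by rewrite !adj_irr.
(* Off the diagonal the entries are [b] times adjacency, and [b] is nonzero because [alpha < 1]. *)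
have := fE x y; rewrite !mxE (negPf xy) (inj_eq (bij_inj f_bij)) (negPf xy) !add0r.
by move/(mulfI b0); case: (H x y) (G _ _) => [] [].
Qed.
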